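(* Let $m\ge 1$ be an integer, let $k$ be an integer, and let $\sigma=2k-2m+2$. Let $T_m=T(2m+1)\cup T(2m+2)$. Then the number of words $w\in T_m$ whose associated knot $K_w$ has signature $\sigma$ is exactly $\binom{2m-1}{k}=\binom{2m-1}{m-1+\frac{\sigma}{2}}$. In other words, \[s(2m+1,\sigma)+s(2m+2,\sigma)=\binom{2m-1}{k},\] where $s(c,\sigma)$ denotes the number of words $w\in T(c)$ with $\sigma(K_w)=\sigma$.
   Context: For an integer $c\ge 3$, $T(c)$ is the set of words in the symbols $\{+,-\}$ of the form $(+)^{\varepsilon_1}(-)^{\varepsilon_2}(+)^{\varepsilon_3}(-)^{\varepsilon_4}\cdots$ with exactly $c$ runs (the $i$-th run consists of $+$'s if $i$ is odd and of $-$'s if $i$ is even), where $\varepsilon_i\in\{1,2\}$ for all $i$, $\varepsilon_1=\varepsilon_c=1$, and the length $\sum_{i=1}^c\varepsilon_i\equiv 1 \pmod 3$. Each $w\in T(c)$ determines an alternating knot diagram $D_w$ with $c$ crossings: replace, from left to right, each run $(+)^1$ or $(-)^2$ by a crossing $\sigma_1$ and each run $(-)^1$ or $(+)^2$ by a crossing $\sigma_2^{-1}$, obtaining a horizontal 3-strand braid read left to right. Here $\sigma_1$ is a crossing between the lower two strands in which the strand going from lower left to upper right is the overstrand, and $\sigma_2^{-1}$ is a crossing between the upper two strands in which the strand going from upper left to lower right is the overstrand. Close up: on the left, join the top and middle ends by a cap; on the right, join the top and middle ends by a cap if $c$ is odd (last crossing is $\sigma_1$), and the middle and bottom ends by a cap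 if $c$ is even (last crossing is $\sigma_2^{-1}$); finally join the remaining left (bottom) end and the remaining right end by an arc that creates no new crossings. The result is a diagram of a 2-bridge knot $K_w$. The signature $\sigma(K)$ is the number of positive minus the number of negative eigenvalues of $V+V^T$ for a Seifert matrix $V$, with the sign convention that the right-handed (positive) trefoil has signature $-2$. For instance $T(3)=\{+--+\}$ gives the left-handed trefoil, of signature $2$. Binomial coefficients $\binom{n}{k}$ are $0$ for $k<0$ or $k>n$. *)

(* Defs.v *)
From HB Require Import structures.
From mathcomp Require Import all_boot all_order all_algebra all_field.
From mathcomp Require Import finmap boolp.

Set Implicit Arguments.
Unset Strict Implicit.
Unset Printing Implicit Defensive.

Import Order.TTheory GRing.Theory Num.Theory.

Local Open Scope ring_scope.

(* With multiplicity; all eigenvalues are real when A is real symmetric. *)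
Definition eigenvalues (n : nat) (A : 'M[algC]_n) : seq algC :=
  sval (closed_field_poly_normal (char_poly A)).

Definition mx_signature (n : nat) (A : 'M[int]_n) : int :=
  let r := eigenvalues (map_mx intr A) in
  (count (fun x => 0 < x) r)%:Z - (count (fun x => x < 0) r)%:Z.

(* A crossing (a, b, c, d) of an unoriented diagram (PD code): the arcs of the
   diagram are labelled by natural numbers, and a, b, c, d are the labels at
   the four ends of the crossing, in counterclockwise order, starting from an
   end of the understrand.  So a, c is the understrand and b, d the overstrand.
   In a diagram every label occurs exactly twice. *)
Definition crossing := (nat * nat * nat * nat)%type.

(* An oriented crossing ((il, ir, or, ol), p), rotated so that both strands
   point upwards: il, ir are the incoming ends at the lower left and lower
   right, or, ol the outgoing ends at the upper right and upper left.  The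
   crossing is positive (p = true) if the strand from il to or is over. *)
Definition ocrossing := (crossing * bool)%type.

Definition in_l (e : ocrossing) : nat := e.1.1.1.1.
Definition in_r (e : ocrossing) : nat := e.1.1.1.2.
Definition out_r (e : ocrossing) : nat := e.1.1.2.
Definition out_l (e : ocrossing) : nat := e.1.2.
Definition positive (e : ocrossing) : bool := e.2.

Definition orientations (x : crossing) : seq ocrossing :=
  let: (a, b, c, d) := x in
  [:: ((a, b, c, d), false); ((b, c, d, a), true);
      ((c, d, a, b), false); ((d, a, b, c), true)].

(* E is P with an orientation of its components: the orientations of the
   crossings agree along every arc, i.e. every arc leaves one crossing and
   enters one crossing. *)
Definition orients (P : seq crossing) (E : seq ocrossing) : bool :=
  let ins := flatten [seq [:: in_l e; in_r e] | e <- E] in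
  let outs := flatten [seq [:: out_r e; out_l e] | e <- E] in
  [&& all2 (fun x e => e \in orientations x) P E, uniq ins & perm_eq ins outs].

(* Let F be the surface given by Seifert's algorithm on the oriented diagram
   E: a disc for every Seifert circle, and a half-twisted band for every
   crossing.  At a crossing e, the Seifert circles have a left arc from in_l e
   to out_l e and a right arc from in_r e to out_r e, and the band joins these
   two arcs.

   A 1-cycle on F running parallel to the Seifert circles and through the
   bands is given by the integer a i of times that it runs along each arc i
   of the diagram (in the direction of the orientation); it crosses the band
   of e from left to right in_l - out_l = out_r - in_r times. *)
Definition chain := nat -> int.

Definition is_cycle (E : seq ocrossing) (a : chain) : bool :=
  all (fun e => a (in_l e) + a (in_r e) == a (out_r e) + a (out_l e)) E.

Definition band (a : chain) (e : ocrossing) : int := a (out_r e) - a (in_r e).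

(* H_1(F) is the group of these cycles modulo the Seifert circles, which bound
   discs in F.  Two cycles are homologous in F iff they cross every band the
   same number of times. *)
Definition homologous (E : seq ocrossing) (a b : chain) : Prop :=
  forall e, e \in E -> band a e = band b e.

Definition is_H1_basis (E : seq ocrossing) (n : nat) (x : 'I_n -> chain) :
    Prop :=
  (forall i, is_cycle E (x i)) /\
  (forall a, is_cycle E a -> exists! z : 'rV[int]_n,
     homologous E a (fun l => \sum_i z 0 i * x i l)).

(* lk(a, b^+), where b^+ is b pushed off F in the positive normal direction
   (the one from which the boundary, oriented as E, is counterclockwise).
   Up to an isotopy, a collar of every Seifert circle in its disc hangs below
   it, as a vertical annulus whose positive normal points to the left of the
   circle; the bands join the upper edges of these annuli.  Then b^+ is, in
   projection, b pushed to the left of the Seifert circles.  The pushoff of the band of e follows it first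
   above and then below, on its upper side in the projection (the side of the
   outgoing ends) if e is positive and on its lower side if e is negative.  So
   the only place where a passes over b^+ is where the band of e, traversed
   by a, passes over the pushed right arc of e, on the lower half of this arc
   if e is positive and on its upper half if e is negative; these passages
   have sign +1 for the directions left-to-right and upwards.  The linking
   number is the signed number of passages of a over b^+. *)
Definition right_arc (e : ocrossing) : nat :=
  if positive e then in_r e else out_r e.

Definition lk_pushoff (E : seq ocrossing) (a b : chain) : int :=
  \sum_(e <- E) band a e * b (right_arc e).

Definition is_Seifert_matrix (E : seq ocrossing) (n : nat) (V : 'M[int]_n) :
    Prop :=
  exists2 x : 'I_n -> chain, is_H1_basis E x &
    V = \matrix_(i, j) lk_pushoff E (x i) (x j).

(* The knot with (unoriented) diagram P has signature s: this depends neither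
   on the orientation nor on the basis.  P is assumed to be connected, so that
   F is. *)
Definition knot_signature (P : seq crossing) (s : int) : Prop :=
  exists2 E : seq ocrossing, orients P E &
  exists n : nat, exists2 V : 'M[int]_n, is_Seifert_matrix E V &
    mx_signature (V + V^T) = s.

(* In a word, true stands for + and false for -. *)
Definition word_of (c : nat) (eps : {ffun 'I_c -> 'I_3}) : seq bool :=
  flatten [seq nseq (eps i) (~~ odd i) | i : 'I_c <- enum 'I_c].

(* The index i : 'I_c starts from 0, so the runs of + have even index. *)
Definition admissible (c : nat) (eps : {ffun 'I_c -> 'I_3}) : bool :=
  [&& [forall i, (eps i == 1%N :> nat) || (eps i == 2 :> nat)],
      [forall i : 'I_c, (i == 0%N :> nat) || (i.+1 == c) ==>
                          (eps i == 1%N :> nat)]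
    & (\sum_(i < c) eps i == 1 %[mod 3])%N].

Definition T (c : nat) : {fset seq bool} :=
  [fset word_of eps | eps : {ffun 'I_c -> 'I_3} & admissible eps]%fset.

Fixpoint runs (w : seq bool) : seq (bool * nat) :=
  if w is x :: w' then
    if runs w' is (y, n) :: r then
      if x == y then (y, n.+1) :: r else (x, 1%N) :: (y, n) :: r
    else [:: (x, 1%N)]
  else [::].

(* true stands for sigma_1, false for sigma_2^-1. *)
Definition letters (w : seq bool) : seq bool :=
  [seq (if p.1 then p.2 == 1%N else p.2 == 2) | p <- runs w].

(* The crossings of a 3-braid whose left ends have labels t, m, b (top, middle,
   bottom), and the labels of its right ends; n is the first unused label.
   Starting from the lower right end for sigma_1 and from the lower left end
   for sigma_2^-1, the ends of the crossing are listed counterclockwise. *)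
Fixpoint braid (s : seq bool) (n t m b : nat) :
    seq crossing * (nat * nat * nat) :=
  match s with
  | [::] => ([::], (t, m, b))
  | true :: s' =>
      let: (P, ends) := braid s' n.+2 t n n.+1 in ((n.+1, n, m, b) :: P, ends)
  | false :: s' =>
      let: (P, ends) := braid s' n.+2 n n.+1 b in ((m, n.+1, n, t) :: P, ends)
  end.

Definition rename (u v l : nat) : nat := if l == u then v else l.

Definition relabel (f : nat -> nat) (x : crossing) : crossing :=
  let: (a, b, c, d) := x in (f a, f b, f c, f d).

(* The cap on the left gives the top and middle ends the label 0, and the
   bottom left end has the label 1.  The arcs on the right identify labels. *)
Definition close_braid (s : seq bool) : seq crossing :=
  let: (P, (t, m, b)) := braid s 2 0 0 1 in
  let f := if odd (size s) then rename m t \o rename b 1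
           else rename m b \o rename t 1 in
  [seq relabel f x | x <- P].

Definition D (w : seq bool) : seq crossing := close_braid (letters w).

Definition count_signature (A : {fset seq bool}) (s : int) : nat :=
  #|` [fset w in A | `[< knot_signature (D w) s >]]%fset|.

Definition binomz (n : nat) (k : int) : nat :=
  if k is Posz j then 'C(n, j) else 0%N.

(* Main.v *)
(* For two cycles on the Seifert surface, lk(a, b+) + lk(b, a+) is the sum over
   the negative crossings minus the sum over the positive crossings of the
   product of the numbers of passages through the band, plus a defect that only
   mixes classes using bands of different signs.  So for a diagram in which
   homology splits into classes supported by negative and by positive bands,
   V + V^T is positive definite on the former and negative definite on the
   latter, and its signature is the difference of their ranks, for every basis.

   At every place of the braid of a word two strands run in one direction and
   the third one in the other; the position of the third one evolves like a
   finite automaton reading the crossings, and the two ranks count certain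
   transitions.  The signature is thus the weight of a path in a three-state
   graph; if t_n and b_n are the generating functions of the paths of length n
   from Top to Top and from Top to Bot, then t_n + b_(n+1) = (x + 1/x)^n. *)
Require Import Defs.
From HB Require Import structures.
From mathcomp Require Import all_boot all_order all_algebra all_field.
From mathcomp Require Import finmap boolp.
From mathcomp Require Import zify ring.

Set Implicit Arguments.
Unset Strict Implicit.
Unset Printing Implicit Defensive.

Import Order.TTheory GRing.Theory Num.Theory.

Local Open Scope ring_scope.
Local Open Scope sesquilinear_scope.

(** * Signature of symmetric integer matrices *)

Lemma char_poly_conj (n : nat) (P A : 'M[algC]_n) :
  P \in unitmx -> char_poly (invmx P *m A *m P) = char_poly A.
Proof.
move=> uP; rewrite /char_poly /char_poly_mx.
have PP : map_mx polyC (invmx P) *m map_mx polyC P = 1%:M.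
  by rewrite -map_mxM mulVmx // map_mx1.
have -> : 'X%:M - map_mx polyC (invmx P *m A *m P) =
    map_mx polyC (invmx P) *m ('X%:M - map_mx polyC A) *m map_mx polyC P.
  rewrite mulmxBr mulmxBl !map_mxM mul_mx_scalar -scalemxAl PP.
  by rewrite scalemx1.
by rewrite !det_mulmx mulrAC -det_mulmx PP det1 mul1r.
Qed.

Lemma spectral_form (n : nat) (A : 'M[algC]_n) (v : 'rV[algC]_n) :
  A \is normalmx ->
  (v *m A *m v^t*) 0 0 =
  \sum_i spectral_diag A 0 i * `|(v *m invmx (spectralmx A)) 0 i| ^+ 2.
Proof.
move=> /orthomx_spectralP {1}->.
have uP := spectral_unitarymx A.
set P := spectralmx A; set d := spectral_diag A; set w := v *m invmx P.
have -> : v *m (invmx P *m diag_mx d *m P) *m v^t* = w *m diag_mx d *m w^t*.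
  rewrite !mulmxA -/w -!mulmxA; congr (_ *m (_ *m _)).
  by rewrite /w invmx_unitary // trmx_mul map_mxM trmxCK.
rewrite mxE; apply: eq_bigr => i _.
by rewrite mul_mx_diag !mxE normCK; ring.
Qed.

Lemma eigenvalues_spectral (n : nat) (A : 'M[algC]_n) :
  A \is normalmx ->
  perm_eq (eigenvalues A) [seq spectral_diag A 0 i | i : 'I_n].
Proof.
move=> nA; apply: prod_XsubC_eq; rewrite /eigenvalues.
case: closed_field_poly_normal => r /= Dr.
rewrite (monicP (char_poly_monic A)) scale1r in Dr; rewrite -Dr.
have /orthomx_spectralP {1}-> := nA.
rewrite char_poly_conj ?unitarymx_unit ?spectral_unitarymx //.
rewrite char_poly_trig ?diag_mx_is_trig // big_map big_enum /=.
by apply: eq_bigr => i _; rewrite !mxE eqxx mulr1n.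
Qed.

(* If p exceeded the number of eigenvalues in S, some nonzero v would have a
   zero coordinate along every eigenvector of eigenvalue in S. *)
Lemma leq_count_spectral (n p : nat) (A : 'M[algC]_n) (U : 'M[algC]_(p, n))
    (S : {pred algC}) :
  A \is normalmx ->
  (forall v : 'rV_p, v != 0 -> ~ forall w : 'rV_n,
     w = v *m U *m invmx (spectralmx A) ->
     forall i, spectral_diag A 0 i \in S -> w 0 i = 0) ->
  (p <= count (mem S) (eigenvalues A))%N.
Proof.
move=> nA hU; rewrite leqNgt; apply/negP.
rewrite (permP (eigenvalues_spectral nA)) count_map => lt_p.
set P := spectralmx A in hU *; set d := spectral_diag A in hU lt_p *.
pose I := [pred i | d 0 i \in S].
have cI : #|I| = count (preim (d 0) (mem S)) (enum 'I_n).
  by rewrite cardE enumT /enum_mem size_filter; apply: eq_count.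
pose M := colsub (fun k : 'I_#|I| => enum_val k) (U *m invmx P).
have rM : (\rank M < p)%N by rewrite (leq_ltn_trans (rank_leq_col M)) ?cI.
have kM : kermx M != 0 by rewrite -mxrank_eq0 mxrank_ker -lt0n subn_gt0.
apply: (hU (nz_row (kermx M))); first by rewrite nz_row_eq0.
move=> w -> i iS.
have /sub_kermxP : (nz_row (kermx M) <= kermx M)%MS by exact: nz_row_sub.
have iI : i \in I by rewrite inE.
move=> /matrixP /(_ 0 (enum_rank_in iI i)).
rewrite [RHS]mxE => <-; rewrite -mulmxA !mxE; apply: eq_bigr => j _.
by rewrite [M _ _]mxE enum_rankK_in.
Qed.


Lemma conj_intr_mx (m n : nat) (M : 'M[int]_(m, n)) :
  (map_mx intr M : 'M[algC]_(m, n))^t* = map_mx intr M^T.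
Proof. by apply/matrixP => i j; rewrite !mxE rmorph_int. Qed.

Lemma intr_mx_hermitian (n : nat) (A : 'M[int]_n) :
  A^T = A -> (map_mx intr A : 'M[algC]_n) \is hermsymmx.
Proof.
by move=> sA; apply/is_hermitianmxP; rewrite expr0 scale1r conj_intr_mx sA.
Qed.

Lemma form_gram (n p r : nat) (e : bool) (A : 'M[int]_n) (U : 'M[int]_(p, n))
    (B : 'M[int]_(p, r)) (v : 'rV[algC]_p) (vU := v *m map_mx intr U) :
  U *m A *m U^T = (-1) ^+ e *: (B *m B^T) ->
  (vU *m map_mx intr A *m vU^t*) 0 0 =
  (-1) ^+ e * \sum_i `|(v *m map_mx intr B) 0 i| ^+ 2.
Proof.
move=> UAU; rewrite /vU trmx_mul map_mxM conj_intr_mx -!mulmxA.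
rewrite [map_mx intr U *m _]mulmxA -map_mxM [_ *m (map_mx _ U^T *m _)]mulmxA.
rewrite -map_mxM UAU map_mxZ rmorph_sign -scalemxAl -scalemxAr mxE.
congr (_ * _).
rewrite map_mxM -conj_intr_mx; set mB := map_mx intr B.
have -> : v *m (mB *m mB^t* *m v^t*) = (v *m mB) *m (v *m mB)^t*.
  by rewrite trmx_mul map_mxM !mulmxA.
rewrite mxE; apply: eq_bigr => i _.
by rewrite [X in _ * X]mxE [in X in _ * X]mxE normCK.
Qed.

(** If [v *m U] had no coordinate along the eigenvectors of the given sign, the form on it would be
    zero or of the opposite sign. It is also a signed sum of squares, so [v *m B] vanishes, and the
    right inverse [B'] gives v = 0. *)
Lemma leq_signed_eigenvalues (n p r : nat) (e : bool) (A : 'M[int]_n)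
    (U : 'M[int]_(p, n)) (B : 'M[int]_(p, r)) (B' : 'M[int]_(r, p)) :
  A^T = A -> U *m A *m U^T = (-1) ^+ e *: (B *m B^T) -> B *m B' = 1%:M ->
  (p <= count (fun x => 0 < (-1) ^+ e * x)%R
          (eigenvalues (map_mx intr A)))%N.
Proof.
move=> sA UAU BB'; have hA := intr_mx_hermitian sA.
have rA := hermitian_spectral_diag_real hA.
have nA := hermitian_normalmx hA.
apply: (@leq_count_spectral n p _ (map_mx intr U)
          [pred x | 0 < (-1) ^+ e * x]) => // v.
move=> /eqP v0 /(_ _ erefl) w0; apply: v0.
have f_ge0 i : 0 <= `|(v *m map_mx intr B) 0 i| ^+ 2 by rewrite exprn_ge0.
have : \sum_i `|(v *m map_mx intr B) 0 i| ^+ 2 <= 0.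
  rewrite -[X in X <= _](signrMK e) -(form_gram _ UAU) spectral_form //.
  rewrite mulr_sumr.
  apply: sumr_le0 => i _; rewrite mulrA.
  set d : algC := (-1) ^+ e * _.
  have : d \is Num.real.
    by apply: realM; [exact: rpred_sign | exact: (mxOverP rA)].
  rewrite realE => /orP[d_ge0 | d_le0].
    have [-> | d0] := eqVneq d 0; first by rewrite mul0r.
    by rewrite w0 ?normr0 ?expr0n ?mulr0 // inE lt_def d0.
  by rewrite mulr_le0_ge0 ?exprn_ge0.
move=> sum_le0; have sum0 : \sum_i `|(v *m map_mx intr B) 0 i| ^+ 2 = 0.
  by apply/eqP; rewrite eq_le sum_le0 sumr_ge0.
have vB0 : v *m map_mx intr B = 0.
  apply/rowP => i; rewrite [RHS]mxE.
  have /(_ i isT)/eqP := psumr_eq0P (fun i _ => f_ge0 i) sum0.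
  by rewrite expf_eq0 normr_eq0 => /eqP.
by rewrite -[v]mulmx1 -(map_mx1 intr) -BB' map_mxM mulmxA vB0 mul0mx.
Qed.

(** The lower bounds p and q are attained, since positive and negative eigenvalues together number
    at most n = p + q. *)
Lemma mx_signature_definite (n p q r s : nat) (A : 'M[int]_n)
    (U : 'M[int]_(p, n)) (B : 'M[int]_(p, r)) (B' : 'M[int]_(r, p))
    (W : 'M[int]_(q, n)) (C : 'M[int]_(q, s)) (C' : 'M[int]_(s, q)) :
  A^T = A -> (p + q)%N = n ->
  U *m A *m U^T = B *m B^T -> B *m B' = 1%:M ->
  W *m A *m W^T = - (C *m C^T) -> C *m C' = 1%:M ->
  mx_signature A = p%:Z - q%:Z.
Proof.
move=> sA pqn UAU BB' WAW CC'.
have := @leq_signed_eigenvalues n p r false A U B B' sA _ BB'.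
rewrite expr0 scale1r => /(_ UAU) p_le.
have := @leq_signed_eigenvalues n q s true A W C C' sA _ CC'.
rewrite expr1 scaleN1r => /(_ WAW) q_le.
rewrite (eq_count (fun x => congr1 (fun y => 0 < y) (mul1r x))) in p_le.
have eqN x : (0 < -1 * x :> algC) = (x < 0) by rewrite mulN1r oppr_gt0.
rewrite (eq_count eqN) in q_le.
rewrite /mx_signature; set ev := eigenvalues _ in p_le q_le *.
have szev : size ev = n.
  rewrite /ev (perm_size (eigenvalues_spectral _)) ?size_image ?card_ord //.
  exact/hermitian_normalmx/intr_mx_hermitian.
have : (count (fun x => 0 < x)%R ev + count (fun x => x < 0)%R ev <= n)%N.
  rewrite -szev -count_predUI -[leqRHS]addn0 leq_add ?count_size //.
  rewrite leqn0 -[_ == _]negbK -lt0n -has_count; apply/hasPn => x _ /=.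
  by apply/negP => /andP[x0 /(lt_trans x0)]; rewrite ltxx.
move: (count _ ev) (count _ ev) p_le q_le => a b; lia.
Qed.

(** * Linking form and signature of a split homology *)

Definition comb (n : nat) (x : 'I_n -> chain) (z : 'rV[int]_n) : chain :=
  fun l => \sum_i z 0 i * x i l.

Lemma band_comb (n : nat) (x : 'I_n -> chain) (z : 'rV[int]_n) e :
  band (comb x z) e = \sum_i z 0 i * band (x i) e.
Proof. by rewrite /band /comb -sumrB; apply: eq_bigr => i _; ring. Qed.

Lemma is_cycle_comb (E : seq ocrossing) (n : nat) (x : 'I_n -> chain) z :
  (forall i, is_cycle E (x i)) -> is_cycle E (comb x z).
Proof.
move=> cx; apply/allP => e eE; rewrite /comb -!big_split /=; apply/eqP.
apply: eq_bigr => i _; rewrite -!mulrDr; congr (_ * _).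
exact/eqP/(allP (cx i)).
Qed.

Lemma is_cycleB (E : seq ocrossing) (a b : chain) :
  is_cycle E a -> is_cycle E b -> is_cycle E (fun l => a l - b l).
Proof.
move=> /allP ca /allP cb; apply/allP => e eE; apply/eqP.
by move/eqP: (ca e eE); move/eqP: (cb e eE); lia.
Qed.

Lemma lk_combl (E : seq ocrossing) (n : nat) (x : 'I_n -> chain) z b :
  lk_pushoff E (comb x z) b = \sum_i z 0 i * lk_pushoff E (x i) b.
Proof.
rewrite /lk_pushoff; under [RHS]eq_bigr do rewrite mulr_sumr.
rewrite exchange_big /=; apply: eq_bigr => e _.
by rewrite band_comb mulr_suml; apply: eq_bigr => i _; rewrite mulrA.
Qed.

Lemma lk_combr (E : seq ocrossing) (n : nat) (x : 'I_n -> chain) z a :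
  lk_pushoff E a (comb x z) = \sum_i z 0 i * lk_pushoff E a (x i).
Proof.
rewrite /lk_pushoff; under [RHS]eq_bigr do rewrite mulr_sumr.
rewrite exchange_big /=; apply: eq_bigr => e _.
by rewrite /comb mulr_sumr; apply: eq_bigr => i _; rewrite mulrCA.
Qed.

Definition defect (E : seq ocrossing) (a b : chain) : int :=
  \sum_(e <- E) (a (out_r e) * b (out_r e) - a (in_r e) * b (in_r e)).

(** Product rule for differences: each crossing contributes the increment of the product of [a] and
    [b] from [in_r] to [out_r], corrected by the product of the two increments; the end chosen by
    [right_arc] decides the sign of the correction. *)
Lemma lk_sym (E : seq ocrossing) (a b : chain) :
  lk_pushoff E a b + lk_pushoff E b a =
  defect E a b - \sum_(e <- E) (-1) ^+ (~~ positive e) * (band a e * band b e).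
Proof.
rewrite -big_split -sumrB /=; apply: eq_bigr => e _.
by rewrite /Defs.right_arc /band; case: positive; rewrite ?expr0 ?expr1; ring.
Qed.

Definition flat (E : seq ocrossing) (s : bool) (a : chain) : Prop :=
  forall e, e \in E -> positive e = s -> band a e = 0.

(* The crossings of N are chosen such that a homology class is determined by
   its passages through their bands, which can be prescribed freely, and that
   the two signs do not interact.  By lk_sym, V + V^T is then positive definite
   on the classes that avoid the positive bands, negative definite on those that
   avoid the negative ones, and these two spaces span. *)
Record split_form (E : seq ocrossing) (N : bool -> seq ocrossing) : Prop := {
  split_sub : forall s e, e \in N s -> e \in E /\ positive e = s;
  split_flat : forall s a, is_cycle E a ->
    (forall e, e \in N s -> band a e = 0) -> flat E s a;
  split_ex : forall z : bool -> seq int,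
    (forall s, size (z s) = size (N s)) ->
    exists2 a, is_cycle E a & forall s, map (band a) (N s) = z s;
  split_defect : forall s a b, is_cycle E a -> is_cycle E b ->
    flat E s a -> flat E s b -> defect E a b = 0 }.


Lemma split_homologous (E : seq ocrossing) (N : bool -> seq ocrossing)
    (a b : chain) :
  split_form E N -> is_cycle E a -> is_cycle E b ->
  (forall s e, e \in N s -> band a e = band b e) -> homologous E a b.
Proof.
move=> spE ca cb ab e eE; apply/eqP; rewrite -subr_eq0.
have /= := split_flat spE (is_cycleB ca cb) _ eE (erefl _).
rewrite /band => <-; first by apply/eqP; ring.
by move=> e' /ab; rewrite /band; lia.
Qed.


Lemma split_dual (E : seq ocrossing) (N : bool -> seq ocrossing)
    (L := N false ++ N true) :
  split_form E N -> exists y : 'I_(size (N false) + size (N true)) -> chain,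
    (forall i, is_cycle E (y i)) /\
    (forall i (j : 'I_(size (N false) + size (N true))) e0,
      band (y i) (nth e0 L j) = (i == j)%:R).
Proof.
move=> spE.
have dual (i : 'I_(size (N false) + size (N true))) : exists a,
    is_cycle E a /\ forall (j : 'I_(size (N false) + size (N true))) e0,
    band a (nth e0 L j) = (i == j)%:R.
  pose z := [seq (i == j :> nat)%:R : int
            | j <- iota 0 (size (N false) + size (N true))].
  have sz : size z = (size (N false) + size (N true))%N.
    by rewrite size_map size_iota.
  pose zs s := if s then drop (size (N false)) z else take (size (N false)) z.
  have [|a ca az] := split_ex spE (z := zs).
    by case; rewrite /= (size_drop, size_take_min) sz; lia.
  exists a; split=> // j e0.
  have bL : map (band a) L = z.
    by rewrite map_cat !az /zs cat_take_drop.
  rewrite -(nth_map _ 0 (band a)) ?size_cat // bL (nth_map 0) ?size_iota //.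
  by rewrite nth_iota.
by have [y yP] := choice dual; exists y; split=> i; have [] := yP i.
Qed.

Lemma split_expand (E : seq ocrossing) (N : bool -> seq ocrossing)
    (L := N false ++ N true)
    (y : 'I_(size (N false) + size (N true)) -> chain) (a : chain) e0 :
  split_form E N -> (forall i, is_cycle E (y i)) ->
  (forall i (j : 'I_(size (N false) + size (N true))),
    band (y i) (nth e0 L j) = (i == j)%:R) -> is_cycle E a ->
  homologous E a
    (comb y (\row_(i < size (N false) + size (N true)) band a (nth e0 L i))).
Proof.
move=> spE cy yP ca; apply: (split_homologous spE) => //.
  exact: is_cycle_comb.
move=> s e eN; have eL : e \in L.
  by rewrite mem_cat; case: s eN => ->; rewrite ?orbT.
have ltL : (index e L < size (N false) + size (N true))%N.
  by rewrite -size_cat index_mem.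
pose k := Ordinal ltL; have -> : e = nth e0 L k by rewrite nth_index.
rewrite band_comb (bigD1 k) // yP eqxx mulr1 mxE big1 => [|i ik].
  by rewrite /= addr0.
by rewrite yP (negPf ik) mulr0.
Qed.

(** The cycles dual to the bands of [N] are a basis: the coordinates of a class are its passages
    through these bands. *)
Lemma split_seifert_matrix (E : seq ocrossing) (N : bool -> seq ocrossing) :
  split_form E N -> exists n : nat, exists V : 'M[int]_n, is_Seifert_matrix E V.
Proof.
move=> spE; have [y [cy yP]] := split_dual spE.
have e0 : ocrossing := (0, 0, 0, 0, true)%N.
exists (size (N false) + size (N true))%N.
exists (\matrix_(i, j) lk_pushoff E (y i) (y j)); exists y => //.
split=> // a ca; exists (\row_(i < size (N false) + size (N true))
          band a (nth e0 (N false ++ N true) i)).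
split; first by apply: split_expand => // i j.
move=> z az; apply/rowP => i; rewrite mxE.
have iL : nth e0 (N false ++ N true) i \in N false ++ N true.
  by rewrite mem_nth ?size_cat.
have iE : nth e0 (N false ++ N true) i \in E.
  by move: iL; rewrite mem_cat => /orP[] /(split_sub spE)[].
rewrite (az _ iE) -[X in band X _]/(comb y z) band_comb (bigD1 i) //=.
rewrite yP eqxx mulr1.
by rewrite big1 ?addr0 // => j ji; rewrite yP (negPf ji) mulr0.
Qed.

(** After passing to the dual cycles, the form on those of one sign is plus or minus a Gram matrix
    of band passages, which is definite; the two ranks add up to n. *)
Lemma split_signature (E : seq ocrossing) (N : bool -> seq ocrossing)
    (n : nat) (V : 'M[int]_n) :
  split_form E N -> is_Seifert_matrix E V ->
  mx_signature (V + V^T) = (size (N false))%:Z - (size (N true))%:Z.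
Proof.
move=> spE [x [cx hx] DV]; have [y [cy yP]] := split_dual spE.
pose e0 : ocrossing := (0, 0, 0, 0, true)%N.
pose L := N false ++ N true.
have Psub i : exists z : 'rV_n, homologous E (y i) (comb x z).
  by have [z [? _]] := hx _ (cy i); exists z.
have [P_ PP] := choice Psub.
(* [P] writes the dual cycles in the basis [x]; [Q] holds the coordinates of [x] in the dual
   cycles. *)
pose P := \matrix_i P_ i.
pose Q := \matrix_(j < n, i < size (N false) + size (N true))
  band (x j) (nth e0 L i).
have LE (i : 'I_(size (N false) + size (N true))) : nth e0 L i \in E.
  have : nth e0 L i \in L by rewrite mem_nth ?size_cat.
  by rewrite mem_cat => /orP[] /(split_sub spE)[].
have PQ : P *m Q = 1%:M.
  apply/matrixP => i k; rewrite !mxE -(yP i k e0) (PP i _ (LE k)) band_comb.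
  by apply: eq_bigr => j _; rewrite !mxE.
have QP : Q *m P = 1%:M.
  (* Row j of both sides gives coordinates of [x j] in the basis [x], and these are unique. *)
  apply/row_matrixP => j; have [z [_ zuniq]] := hx _ (cx j).
  transitivity z; first (symmetry; apply: zuniq).
    apply: (split_homologous spE) => //; first exact: is_cycle_comb.
    move=> s e eN.
    have eL : e \in L by rewrite mem_cat; case: s eN => ->; rewrite ?orbT.
    have ltL : (index e L < size (N false) + size (N true))%N.
      by rewrite -size_cat index_mem.
    pose k := Ordinal ltL; have -> : e = nth e0 L k by rewrite nth_index.
    rewrite -[X in _ = band X _]/(comb x _) band_comb.
    transitivity ((Q *m P *m Q) j k).
      by rewrite -mulmxA PQ mulmx1 mxE.
    by rewrite mxE; apply: eq_bigr => i _; rewrite [Q i k]mxE [in RHS]mxE.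
  apply: zuniq => e eE; rewrite -[X in _ = band X _]/(comb x _) band_comb.
  rewrite (bigD1 j) //= !mxE eqxx mul1r big1 ?addr0 // => i ij.
  by rewrite !mxE eq_sym (negPf ij) mul0r.
have Dn : (size (N false) + size (N true))%N = n.
  by apply/eqP; rewrite eqn_leq (mulmx1_min PQ) (mulmx1_min QP).
pose y' i := comb x (P_ i).
have cy' i : is_cycle E (y' i) by exact: is_cycle_comb.
have by' i (k : 'I_(size (N false) + size (N true))) :
    band (y' i) (nth e0 L k) = (i == k)%:R by rewrite -(PP i _ (LE k)).
have form i k : (P *m (V + V^T) *m P^T) i k =
    lk_pushoff E (y' i) (y' k) + lk_pushoff E (y' k) (y' i).
  have lkP i' k' : (P *m V *m P^T) i' k' = lk_pushoff E (y' i') (y' k').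
    rewrite lk_combr mxE; apply: eq_bigr => j _; rewrite lk_combl !mxE mulrC.
    by congr (_ * _); apply: eq_bigr => l _; rewrite DV !mxE.
  rewrite mulmxDr mulmxDl mxE lkP; congr (_ + _).
  have -> : P *m V^T *m P^T = (P *m V *m P^T)^T.
    by rewrite !trmx_mul trmxK mulmxA.
  by rewrite mxE lkP.
(* Flatness kills the defect and the bands of the other sign, so a single sign survives in
   [lk_sym]. *)
have gram s i k : flat E (~~ s) (y' i) -> flat E (~~ s) (y' k) ->
    (P *m (V + V^T) *m P^T) i k =
    (-1) ^+ s * \sum_(j < size E) band (y' i) (tnth (in_tuple E) j) *
                                  band (y' k) (tnth (in_tuple E) j).
  move=> fi fk; rewrite form lk_sym (split_defect spE _ _ fi fk) // sub0r.
  rewrite -sumrN mulr_sumr (big_tnth _ _ E); apply: eq_bigr => j _.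
  have eE : tnth (in_tuple E) j \in E by rewrite mem_tnth.
  have [ps|/negP ps] := eqVneq (positive (tnth (in_tuple E) j)) s.
    by rewrite ps; case: s {fi fk ps}; rewrite ?expr0 ?expr1; ring.
  rewrite fi ?mul0r ?mulr0 ?oppr0 //.
  by case: positive ps; case: (s).
pose mB (m : nat) (h : 'I_m -> 'I_(size (N false) + size (N true))) :=
  \matrix_(i < m, j < size E) band (y' (h i)) (tnth (in_tuple E) j).
(* [mB'] selects the columns of the dual bands, where [mB] contains an identity block. *)
pose mB' (m : nat) (h : 'I_m -> 'I_(size (N false) + size (N true))) :=
  \matrix_(j < size E, i < m)
    (j == index (nth e0 L (h i)) E :> nat)%:R : 'M[int]__.
have mBB' m (h : 'I_m -> _) : injective h -> mB m h *m mB' m h = 1%:M.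
  move=> h_inj; apply/matrixP => i k; rewrite !mxE.
  have ltE : (index (nth e0 L (h k)) E < size E)%N by rewrite index_mem LE.
  rewrite (bigD1 (Ordinal ltE)) //= !mxE eqxx mulr1 (tnth_nth e0) /=.
  rewrite nth_index ?LE // by' (inj_eq h_inj) big1 ?addr0 // => j.
  by rewrite -val_eqE /= !mxE => /negPf ->; rewrite mulr0.
have flatf i : flat E true (y' (lshift _ i)).
  apply: (split_flat spE) => // e eN.
  have ltN : (index e (N true) < size (N true))%N by rewrite index_mem.
  have -> : e = nth e0 L (rshift (size (N false)) (Ordinal ltN)).
    by rewrite nth_cat /= ltnNge leq_addr addKn nth_index.
  by rewrite by' eq_lrshift.
have flatt i : flat E false (y' (rshift _ i)).
  apply: (split_flat spE) => // e eN.
  have ltN : (index e (N false) < size (N false))%N by rewrite index_mem.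
  have -> : e = nth e0 L (lshift (size (N true)) (Ordinal ltN)).
    by rewrite nth_cat /= ltN nth_index.
  by rewrite by' eq_rlshift.
apply: (@mx_signature_definite n _ _ _ _ _ (usubmx P) (mB _ (@lshift _ _))
         (mB' _ (@lshift _ _)) (dsubmx P) (mB _ (@rshift _ _))
         (mB' _ (@rshift _ _))) => //.
- by rewrite raddfD /= trmxK addrC.
- apply/matrixP => i k; rewrite trmx_usub !mul_usub_mx mulmx_lsub.
  rewrite [LHS]mxE [LHS]mxE (gram false) // expr0 mul1r [RHS]mxE.
  by apply: eq_bigr => j _; rewrite !mxE.
- apply: mBB'; exact: lshift_inj.
- apply/matrixP => i k; rewrite trmx_dsub !mul_dsub_mx mulmx_rsub.
  rewrite [LHS]mxE [LHS]mxE (gram true) // expr1 mulN1r [RHS]mxE [in RHS]mxE.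
  by congr (- _); apply: eq_bigr => j _; rewrite !mxE.
- apply: mBB'; exact: rshift_inj.
Qed.

(** * Reversal and relabelling of oriented diagrams *)

Definition ins (E : seq ocrossing) : seq nat :=
  flatten [seq [:: in_l e; in_r e] | e <- E].

Definition outs (E : seq ocrossing) : seq nat :=
  flatten [seq [:: out_r e; out_l e] | e <- E].

Lemma sum_ins (E : seq ocrossing) (g : nat -> int) :
  \sum_(l <- ins E) g l = \sum_(e <- E) (g (in_l e) + g (in_r e)).
Proof.
rewrite big_flatten big_map; apply: eq_bigr => e _.
by rewrite !big_cons big_nil /= addr0.
Qed.

Lemma sum_outs (E : seq ocrossing) (g : nat -> int) :
  \sum_(l <- outs E) g l = \sum_(e <- E) (g (out_r e) + g (out_l e)).
Proof.
rewrite big_flatten big_map; apply: eq_bigr => e _.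
by rewrite !big_cons big_nil /= addr0.
Qed.

(** Reversing both strands turns the picture by half a turn and keeps the sign. *)
Definition reverse (e : ocrossing) : ocrossing :=
  ((out_r e, out_l e, in_l e, in_r e), positive e).

Lemma is_cycle_reverse (E : seq ocrossing) (a : chain) :
  is_cycle (map reverse E) a = is_cycle E a.
Proof. by rewrite /is_cycle all_map; apply: eq_all => e /=; rewrite eq_sym. Qed.

Lemma band_reverse (E : seq ocrossing) (a : chain) e :
  is_cycle E a -> e \in E -> band a (reverse e) = band a e.
Proof.
case: e => [[[[il ir] or] ol] p] /allP ca /ca /eqP.
by rewrite /band /reverse /in_l /in_r /out_l /out_r /=; lia.
Qed.

Lemma flat_reverse (E : seq ocrossing) (s : bool) (a : chain) :
  is_cycle E a -> flat (map reverse E) s a <-> flat E s a.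
Proof.
move=> ca; split=> fa e eE ps.
  by rewrite -(band_reverse ca eE) fa // map_f.
by move: eE ps => /mapP[e' eE' ->] ps; rewrite (band_reverse ca) // fa.
Qed.

(** Conservation at a crossing makes its left and right arcs give the same band value. The two
    defects differ by a sum over all ends, which vanishes because each arc leaves and enters equally
    often. *)
Lemma split_form_reverse (E : seq ocrossing) (N : bool -> seq ocrossing) :
  perm_eq (ins E) (outs E) -> split_form E N ->
  split_form (map reverse E) (fun s => map reverse (N s)).
Proof.
move=> io spE; split.
- by move=> s _ /mapP[e eN ->]; have [? ?] := split_sub spE eN; rewrite map_f.
- move=> s a; rewrite is_cycle_reverse => ca hN; apply/(flat_reverse s ca).
  apply: (split_flat spE ca) => e eN; have [eE _] := split_sub spE eN.
  by rewrite -(band_reverse ca eE) hN // map_f.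
- move=> z sz; have [s|a ca az] := split_ex spE (z := z).
    by rewrite sz size_map.
  exists a => [|s]; first by rewrite is_cycle_reverse.
  rewrite -az -map_comp; apply/eq_in_map => e /(split_sub spE)[eE _] /=.
  exact: band_reverse eE.
- move=> s a b; rewrite !is_cycle_reverse => ca cb.
  move=> /(flat_reverse s ca) fa /(flat_reverse s cb) fb.
  rewrite -(split_defect spE ca cb fa fb).
  apply/eqP; rewrite -subr_eq0 /defect big_map -sumrB; apply/eqP.
  have /eqP := perm_big _ io (op := +%R) (x := 0) (P := predT)
    (F := fun l => a l * b l).
  rewrite /= sum_ins sum_outs -subr_eq0 -sumrB => /eqP {}io.
  rewrite -[RHS]io; apply: eq_bigr => e _.
  by case: e => [[[[il ir] or] ol] p]; rewrite /in_l /out_l /=; ring.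
Qed.

Definition orelabel (f : nat -> nat) (e : ocrossing) : ocrossing :=
  ((f (in_l e), f (in_r e), f (out_r e), f (out_l e)), positive e).

Lemma is_cycle_orelabel f (E : seq ocrossing) (a : chain) :
  is_cycle (map (orelabel f) E) a = is_cycle E (a \o f).
Proof. by rewrite /is_cycle all_map. Qed.

Lemma defect_orelabel f (E : seq ocrossing) (a b : chain) :
  defect (map (orelabel f) E) a b = defect E (a \o f) (b \o f).
Proof. by rewrite /defect big_map. Qed.

Lemma flat_orelabel f (E : seq ocrossing) (s : bool) (a : chain) :
  flat (map (orelabel f) E) s a <-> flat E s (a \o f).
Proof.
split=> fa e eE ps; first exact: (fa (orelabel f e) (map_f _ eE)).
by move: eE ps => /mapP[e' eE' ->] ps; exact: (fa e' eE' ps).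
Qed.

(** * Oriented braids, flux and defect *)

(* The position of the strand that runs against the other two at a given place
   of the braid.  Mid records whether Top or Bot was left last. *)
Inductive state := Top | Mid of bool | Bot.

Definition step (q : state) (x : bool) : state :=
  match q, x with
  | Top, true => Top
  | Top, false => Mid true
  | Mid _, true => Bot
  | Mid _, false => Top
  | Bot, true => Mid false
  | Bot, false => Bot
  end.

(* The crossing with left ends t, m, b and new right ends n, n.+1, when the
   strand at position q runs to the left and the others to the right. *)
Definition ocross (q : state) (x : bool) (n t m b : nat) : ocrossing :=
  match q, x with
  | Top, true => ((m, b, n.+1, n), false)
  | Mid _, true => ((b, n.+1, n, m), true)
  | Bot, true => ((n, m, b, n.+1), true)
  | Top, false => ((m, n.+1, n, t), false)
  | Mid _, false => ((n, t, m, n.+1), false)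
  | Bot, false => ((t, m, n.+1, n), true)
  end.

Fixpoint obraid (s : seq bool) (q : state) (n t m b : nat) : seq ocrossing :=
  if s is x :: s' then
    ocross q x n t m b ::
    (if x then obraid s' (step q x) n.+2 t n n.+1
     else obraid s' (step q x) n.+2 n n.+1 b)
  else [::].

(* Net flow to the right of the three strands, of the upper two and of the lower
   two.  In terms of flow, sigma_1 only changes upper and sigma_2^-1 only
   changes lower; up to sign, a negative band carries upper or its change, and
   a positive band carries lower or its change. *)
Definition flux (q : state) (t m b : int) : int :=
  match q with Top => m + b - t | Mid _ => t + b - m | Bot => t + m - b end.

Definition upper (q : state) (t m : int) : int :=
  match q with Top => m - t | Mid _ => t - m | Bot => t + m end.

Definition lower (q : state) (m b : int) : int :=
  match q with Top => m + b | Mid _ => b - m | Bot => m - b end.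

Definition final (s : seq bool) (q : state) : state := foldl step q s.

Definition ends (s : seq bool) (n t m b : nat) : nat * nat * nat :=
  (braid s n t m b).2.

Lemma ends_true s n t m b : ends (true :: s) n t m b = ends s n.+2 t n n.+1.
Proof. by rewrite /ends /=; case: braid. Qed.

Lemma ends_false s n t m b : ends (false :: s) n t m b = ends s n.+2 n n.+1 b.
Proof. by rewrite /ends /=; case: braid. Qed.

Definition at_ends (A : Type) (F : int -> int -> int -> A) (g : nat -> int)
    (l : nat * nat * nat) : A := F (g l.1.1) (g l.1.2) (g l.2).

(** Each crossing changes the flux by its outgoing minus its incoming values. For a cycle this is
    conservation of flux; for the indicator function of a label it counts the ends with that
    label. *)
Lemma flux_obraid (g : nat -> int) s q n t m b :
  \sum_(e <- obraid s q n t m b)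
    (g (out_r e) + g (out_l e) - (g (in_l e) + g (in_r e))) =
  at_ends (flux (final s q)) g (ends s n t m b) - flux q (g t) (g m) (g b).
Proof.
elim: s q n t m b => [|x s IHs] q n t m b.
  by rewrite big_nil /at_ends /= subrr.
case: x; rewrite ?ends_true ?ends_false big_cons IHs /=;
case: q => [|?|] /=; rewrite /in_l /in_r /out_l /out_r /=; ring.
Qed.

(* Telescopes the defect along the braid, up to cross_term. *)
Definition potential (q : state) (t m b t' m' b' : int) : int :=
  match q with
  | Top => b * b'
  | Mid _ => (t + b - m) * (t' + b' - m')
  | Bot => (t + m - b) * (t' + m' - b') + m * m' - b * b'
  end.

(** The part of the defect that does not telescope: it arises only at sigma_2^-1 into or out of
    [Mid], and pairs [lower] of one chain with [upper] of the other. *)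
Fixpoint cross_term (s : seq bool) (q : state) (n t m b : nat) (a a' : chain) :
    int :=
  match s with
  | [::] => 0
  | true :: s' => cross_term s' (step q true) n.+2 t n n.+1 a a'
  | false :: s' =>
    match q with
    | Top => lower (Mid true) (a n.+1) (a b) * upper Top (a' t) (a' m)
    | Mid f => - (lower (Mid f) (a m) (a b) * upper (Mid f) (a' t) (a' m))
    | Bot => 0
    end + cross_term s' (step q false) n.+2 n n.+1 b a a'
  end.

Lemma defect_obraid (a a' : chain) s q n t m b (l := ends s n t m b) :
  is_cycle (obraid s q n t m b) a -> is_cycle (obraid s q n t m b) a' ->
  defect (obraid s q n t m b) a a' =
  potential (final s q) (a l.1.1) (a l.1.2) (a l.2)
                        (a' l.1.1) (a' l.1.2) (a' l.2) -
  potential q (a t) (a m) (a b) (a' t) (a' m) (a' b) -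
  (cross_term s q n t m b a a' + cross_term s q n t m b a' a).
Proof.
rewrite {}/l /defect; elim: s q n t m b => [|x s IHs] q n t m b.
  by move=> _ _; rewrite big_nil /=; ring.
case: x; rewrite ?ends_true ?ends_false big_cons /= =>
  /andP[/eqP/(canRL (addrK _)) ce ca] /andP[/eqP/(canRL (addrK _)) ce' ca'];
  rewrite IHs //; move: ce ce'.
all: case: q {IHs ca ca'} => [|?|] /=; rewrite /in_l /in_r /out_l /out_r /=.
all: by move=> ce ce'; rewrite ?ce ?ce'; ring.
Qed.

Lemma flat_cons (e : ocrossing) (E : seq ocrossing) (s : bool) (a : chain) :
  flat (e :: E) s a <-> (positive e = s -> band a e = 0) /\ flat E s a.
Proof.
split=> [fa | [fe fE] e']; last by rewrite inE => /orP[/eqP -> //|]; exact: fE.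
split=> [|e' eE]; first by apply: fa; rewrite mem_head.
by apply: fa; rewrite inE eE orbT.
Qed.

(** Every contributing crossing is negative, and its band carries the factor [upper] of [a'] up to
    sign. *)
Lemma cross_term_flat_negative (a a' : chain) s q n t m b :
  is_cycle (obraid s q n t m b) a' -> flat (obraid s q n t m b) false a' ->
  cross_term s q n t m b a a' = 0.
Proof.
elim: s q n t m b => [//|x s IHs] q n t m b /=.
case: x => /andP[/eqP ce ca'] /flat_cons[fe fE]; rewrite IHs //.
move: ce fe; case: q {IHs ca' fE} => [|f|] //=.
all: rewrite /band /in_l /in_r /out_l /out_r /= => ce /(_ erefl) fe.
  have -> : a' m - a' t = 0 by lia.
  by rewrite mulr0 addr0.
have -> : a' t - a' m = 0 by lia.
by rewrite mulr0 oppr0 addr0.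
Qed.

(** When [Mid] is entered from [Top] and left to [Top], the two terms cancel, since sigma_2^-1 keeps
    [upper]. When it is entered from or left to [Bot], a positive band forces [lower] of [a] to
    vanish. Only a start in [Mid] leaves an unmatched term. *)
Lemma cross_term_flat_positive (a a' : chain) s q n t m b :
  is_cycle (obraid s q n t m b) a -> flat (obraid s q n t m b) true a ->
  is_cycle (obraid s q n t m b) a' ->
  (if final s q is Mid _ then False else True) ->
  cross_term s q n t m b a a' =
  if q is Mid f then - (lower q (a m) (a b) * upper q (a' t) (a' m)) else 0.
Proof.
elim: s q n t m b => [|x s IHs] q n t m b; first by case: q.
rewrite /=.
case: x => /andP[/eqP ce ca] /flat_cons[fe fE] /andP[/eqP ce' ca'] fin;
  rewrite IHs //.
all: move: ce ce' fe; case: q {IHs ca ca' fE fin} => [|f|] //=.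
all: rewrite /band /in_l /in_r /out_l /out_r /= => ce ce'.
- move=> /(_ erefl) fe; have -> : a b - a m = 0 by lia.
  by rewrite mul0r oppr0.
- move=> /(_ erefl) fe; have -> : a n.+1 - a n = 0 by lia.
  by rewrite mul0r oppr0.
- move=> _; have -> : a' n - a' n.+1 = a' m - a' t by lia.
  by ring.
- by move=> _; ring.
Qed.

(** * Essential crossings and the cycles they determine *)

(* The crossings whose bands are not determined by the bands on their left (and
   by the closing, for the last crossing). *)
Definition is_essential (sg : bool) (q : state) (x last : bool) : bool :=
  match sg, q, x with
  | false, Top, true => ~~ last
  | false, Mid false, false => true
  | true, Mid true, true => true
  | true, Bot, false => ~~ last
  | _, _, _ => false
  end.

Fixpoint essential (sg : bool) (s : seq bool) (q : state) (n t m b : nat) :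
    seq ocrossing :=
  if s is x :: s' then
    (if is_essential sg q x (nilp s') then cons (ocross q x n t m b) else id)
      (if x then essential sg s' (step q x) n.+2 t n n.+1
       else essential sg s' (step q x) n.+2 n n.+1 b)
  else [::].

Fixpoint nb_essential (sg : bool) (s : seq bool) (q : state) : nat :=
  if s is x :: s' then
    (is_essential sg q x (nilp s') + nb_essential sg s' (step q x))%N
  else 0%N.

Lemma size_essential sg s q n t m b :
  size (essential sg s q n t m b) = nb_essential sg s q.
Proof.
elim: s q n t m b => [//|x s IHs] q n t m b /=.
by case: is_essential; case: x; rewrite /= IHs.
Qed.

Lemma essential_sub sg s q n t m b e :
  e \in essential sg s q n t m b ->
  e \in obraid s q n t m b /\ positive e = sg.
Proof.
elim: s q n t m b => [//|x s IHs] q n t m b /=.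
have tail : e \in (if x then essential sg s (step q x) n.+2 t n n.+1
       else essential sg s (step q x) n.+2 n n.+1 b) ->
    e \in (if x then obraid s (step q x) n.+2 t n n.+1
       else obraid s (step q x) n.+2 n n.+1 b) /\ positive e = sg.
  by case: (x) => /IHs.
case ess: is_essential; rewrite /= ?inE; last first.
  by move=> /tail[-> ->]; rewrite orbT.
case/orP=> [/eqP ->|/tail[-> ->]]; last by rewrite orbT.
rewrite eqxx; split=> //.
by clear IHs tail; case: sg q x ess => [] [|[]|] [].
Qed.

(* In a pinned state upper is determined by the negative bands on the left and
   lower is free; otherwise lower is determined by the positive bands and upper
   is free. *)
Definition pinned (q : state) : bool :=
  match q with Top | Mid true => true | Bot | Mid false => false end.

Lemma band_essential_cons sg q x last a e E :
  (forall e', e' \in (if is_essential sg q x last then cons e else id) E ->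
     band a e' = 0) ->
  (is_essential sg q x last -> band a e = 0) /\
  (forall e', e' \in E -> band a e' = 0).
Proof.
case: is_essential => hE; last by split.
by split=> [_|e' eE]; apply: hE; rewrite inE ?eqxx ?eE ?orbT.
Qed.

(** The invariant is that [upper] vanishes in pinned states: on the way from a state that is not
    pinned to a pinned one, an essential band carries [upper]. *)
Lemma flat_negative_obraid (a : chain) s q n t m b (l := ends s n t m b) :
  is_cycle (obraid s q n t m b) a ->
  (forall e, e \in essential false s q n t m b -> band a e = 0) ->
  (pinned q -> upper q (a t) (a m) = 0) ->
  (final s q = Top -> upper Top (a l.1.1) (a l.1.2) = 0) ->
  flat (obraid s q n t m b) false a.
Proof.
rewrite {}/l; elim: s q n t m b => [//|x s IHs] q n t m b.
rewrite /obraid -/obraid; case: x; rewrite ?ends_true ?ends_false.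
all: rewrite [is_cycle _ _]/= [essential _ _ _ _ _ _ _]/essential -/essential.
all: move=> /andP[/eqP ce ca] /band_essential_cons[e0 eE] pin fin.
all: have {}IHs := IHs _ _ _ _ _ ca eE _ fin.
all: move: ce e0 pin fin.
all: rewrite /band /in_l /in_r /out_l /out_r /=.
all: case: q {ca eE} IHs => [|[]|] /= IHs ce e0 pin fin.
all: apply/flat_cons; rewrite /band /in_l /in_r /out_l /out_r /=.
  (* For sigma_1 in [Top] the band is the change of [upper]; at the last crossing, which is not
     essential, [fin] replaces the band condition. *)
  have u0 : a n - a t = 0.
    case: s {IHs} e0 fin => [|x s] /=; first by move=> _; exact.
    by move=> /(_ isT); have := pin isT; lia.
  by split=> [_|]; [have := pin isT; lia | exact: IHs].
all: split=> [sg|]; [try by [] | apply: IHs => // _].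
all: try (have := pin isT); try (have := e0 isT); lia.
Qed.

Lemma flat_positive_obraid (a : chain) s q n t m b (l := ends s n t m b) :
  is_cycle (obraid s q n t m b) a ->
  (forall e, e \in essential true s q n t m b -> band a e = 0) ->
  (~~ pinned q -> lower q (a m) (a b) = 0) ->
  (final s q = Bot -> lower Bot (a l.1.2) (a l.2) = 0) ->
  flat (obraid s q n t m b) true a.
Proof.
rewrite {}/l; elim: s q n t m b => [//|x s IHs] q n t m b.
rewrite /obraid -/obraid; case: x; rewrite ?ends_true ?ends_false.
all: rewrite [is_cycle _ _]/= [essential _ _ _ _ _ _ _]/essential -/essential.
all: move=> /andP[/eqP ce ca] /band_essential_cons[e0 eE] pin fin.
all: have {}IHs := IHs _ _ _ _ _ ca eE _ fin.
all: move: ce e0 pin fin.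
all: rewrite /band /in_l /in_r /out_l /out_r /=.
all: case: q {ca eE} IHs => [|[]|] /= IHs ce e0 pin fin.
all: apply/flat_cons; rewrite /band /in_l /in_r /out_l /out_r /=.
(* The eighth case is sigma_2^-1 in [Bot], where the band is the change of [lower]; again [fin]
   serves at the last crossing. *)
8: { have u0 : a n.+1 - a b = 0.
    case: s {IHs} e0 fin => [|x s] /=; first by move=> _; exact.
    by move=> /(_ isT); have := pin isT; lia.
  by split=> [_|]; [have := pin isT; lia | exact: IHs]. }
all: split=> [sg|]; [try by [] | apply: IHs => // _].
all: try (have := pin isT); try (have := e0 isT); lia.
Qed.

(** The outer strand not touched by the last crossing is the one that runs backwards. *)
Fixpoint closes (s : seq bool) (q : state) : bool :=
  match s with
  | [::] => false
  | [:: x] => match q with Top => x | Mid _ => false | Bot => ~~ x end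
  | x :: s' => closes s' (step q x)
  end.

(* The values of a cycle with flux 0, upper = u and lower = l. *)
Definition top_value (q : state) (l : int) : int :=
  match q with Top => l | Mid _ | Bot => - l end.

Definition mid_value (q : state) (u l : int) : int :=
  match q with Top | Bot => u + l | Mid _ => - u - l end.

Definition bot_value (q : state) (u : int) : int :=
  match q with Top | Mid _ => - u | Bot => u end.

(** New labels are consecutive, so a solution is stored as the list [v] of its values on them,
    independently of the labels; this lets solutions be extended on the left. *)
Definition realizes (s : seq bool) (q : state) (z : bool -> seq int)
    (u l : int) (v : seq int) : Prop :=
  forall n t m b (a : chain), a t = top_value q l -> a m = mid_value q u l ->
  a b = bot_value q u -> (forall i, (i < size v)%N -> a (n + i)%N = v`_i) ->
  [/\ is_cycle (obraid s q n t m b) a,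
      forall sg, map (band a) (essential sg s q n t m b) = z sg &
      if final s q is Top then upper Top (a (ends s n t m b).1.1)
                                     (a (ends s n t m b).1.2) = 0
      else lower Bot (a (ends s n t m b).1.2) (a (ends s n t m b).2) = 0].

Lemma realizes_cons x s q z z' u l u' l' v :
  realizes s (step q x) z' u' l' v ->
  (if x then l' = l else u' = u) ->
  (forall n t m b a e, e = ocross q x n t m b ->
     a t = top_value q l -> a m = mid_value q u l -> a b = bot_value q u ->
     a n = (if x then mid_value (step q x) u' l'
            else top_value (step q x) l') ->
     a n.+1 = (if x then bot_value (step q x) u'
               else mid_value (step q x) u' l') ->
     forall sg, z sg = (if is_essential sg q x (nilp s)
                        then cons (band a e) else id) (z' sg)) ->
  realizes (x :: s) q z u l
    ((if x then mid_value (step q x) u' l' else top_value (step q x) l') ::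
     (if x then bot_value (step q x) u' else mid_value (step q x) u' l') :: v).
Proof.
move=> zv ul zz n t m b a at_ am ab av.
have an := av 0%N isT; rewrite addn0 /= in an.
have an1 := av 1%N isT; rewrite addn1 /= in an1.
have {}av i : (i < size v)%N -> a (n.+2 + i)%N = v`_i.
  by move=> iv; have := av i.+2; rewrite !addnS !addSn => ->.
have zE := zz n t m b a _ erefl at_ am ab an an1.
have [ca ez fin] : [/\ is_cycle (behead (obraid (x :: s) q n t m b)) a,
    forall sg, map (band a) (if x then essential sg s (step q x) n.+2 t n n.+1
       else essential sg s (step q x) n.+2 n n.+1 b) = z' sg &
    if final (x :: s) q is Top
    then upper Top (a (ends (x :: s) n t m b).1.1)
                   (a (ends (x :: s) n t m b).1.2) = 0
    else lower Bot (a (ends (x :: s) n t m b).1.2)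
                   (a (ends (x :: s) n t m b).2) = 0].
  clear zz zE; case: x zv ul an an1 => zv ul an an1.
    by rewrite ends_true; apply: zv => //; rewrite at_ ul; case: (q).
  by rewrite ends_false; apply: zv => //; rewrite ab ul; case: (q).
split=> // [|sg].
  rewrite /= in ca *; rewrite ca andbT; apply/eqP.
  move: ul at_ am ab an an1.
  clear zv zE zz ez fin ca; by case: x; case: q => [|f|] /= ul at_ am ab an an1;
    rewrite /in_l /in_r /out_l /out_r /=; lia.
rewrite zE -ez /=; case: is_essential => //=.
Qed.

Lemma realizes_nil q u l :
  (if q is Top then u = 0 else l = 0) ->
  (if q is Mid _ then False else True) ->
  realizes [::] q (fun=> [::]) u l [::].
Proof.
case: q => // ul _ n t m b a at_ am ab _; rewrite /ends /=.
all: by split=> //; move: at_ am ab; rewrite /= ul; lia.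
Qed.

(** In a pinned state [upper] can be prescribed and [lower] must adapt to the later bands; otherwise
    the roles are exchanged. *)
Lemma realizes_exists s q (z : bool -> seq int) (u l : int) :
  closes s q -> (forall sg, size (z sg) = nb_essential sg s q) ->
  exists u' l' v, [/\ size v = (2 * size s)%N,
    if pinned q then u' = u else l' = l & realizes s q z u' l' v].
Proof.
elim: s q z u l => [//|x s IHs] q z u l cl sz.
case: s IHs cl sz => [|y s] IHs cl sz.
  have z0 sg : z sg = [::].
    apply: size0nil; rewrite sz; move: cl.
    by case: (q) (sg) (x) => [|[]|] [] [].
  have zz : realizes [::] (step q x) (fun=> [::]) 0 0 [::].
    by apply: realizes_nil; case: (q) (x) cl => [|f|] [].
  (* The last crossing is not essential and brings both [upper] and [lower] to 0. *)
  exists (if pinned q then u else 0), (if pinned q then 0 else l).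
  eexists; split; last first.
  - apply: (realizes_cons zz); first by case: (q) (x) cl => [|f|] [].
    move=> n t m b a e _ _ _ _ _ _ sg; rewrite z0; move: cl.
    by case: (q) (sg) (x) => [|[]|] [] [].
  - by case: pinned.
  - by [].
have {cl} {}IHs z' u' l' := IHs (step q x) z' u' l' cl.
set s' := y :: s in sz IHs *.
pose z' sg := if is_essential sg q x (nilp s') then behead (z sg) else z sg.
have sz' sg : size (z' sg) = nb_essential sg s' (step q x).
  by rewrite /z'; have := sz sg; rewrite [nb_essential _ _ _]/=;
     case: is_essential => //= ?; rewrite size_behead; lia.
pose z1 sg : int := head 0 (z sg).
have zE sg : is_essential sg q x (nilp s') -> z sg = z1 sg :: z' sg.
  rewrite /z1 /z'; have := sz sg; rewrite [nb_essential _ _ _]/=.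
  by case: is_essential => //; case: (z sg).
have zE' sg : is_essential sg q x (nilp s') = false -> z sg = z' sg.
  by rewrite /z' => ->.
(* The quantity prescribed after the crossing is solved from the equation that its essential band
   has value [z1]. *)
have [u1 [l1 [v [sv pin zv]]]] := IHs z'
  (match q, x with
   | Top, true => u - z1 false | Mid false, false => - z1 false | _, _ => u
   end)
  (match q, x with
   | Bot, false => l + z1 true | Mid true, true => z1 true | _, _ => l
   end) sz'.
(* sigma_1 keeps [lower] and sigma_2^-1 keeps [upper]; a quantity neither prescribed nor kept is set
   to 0. *)
exists (if pinned q then u else if x then 0 else u1),
  (if pinned q then if x then l1 else 0 else l).
eexists; split; last first.
- apply: (realizes_cons zv).
    by case: (q) (x) pin => [|[]|] [].
  move=> n t m b a e -> {zv sv IHs sz sz'} at_ am ab an an1 sg.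
  case ess: is_essential; last exact: zE'.
  rewrite zE //; congr (_ :: _).
  clear zE zE' z'; move: pin at_ am ab an an1 ess; rewrite /band /in_r /out_r.
  case: q x sg => [|[]|] [] [] //=; lia.
- by case: pinned.
- by rewrite [size _]/= sv [in RHS]/= mulnS.
Qed.

(** * Closing the braid *)

Definition closing (s : seq bool) : nat -> nat :=
  let: (t, m, b) := ends s 2 0 0 1 in
  if odd (size s) then rename m t \o rename b 1 else rename m b \o rename t 1.

Lemma close_braidE s :
  close_braid s = map (relabel (closing s)) (braid s 2 0 0 1).1.
Proof. by rewrite /close_braid /closing /ends; case: braid => P [[t m] b]. Qed.

Definition closed_chain (s : seq bool) (a : chain) : Prop :=
  let: (t, m, b) := ends s 2 0 0 1 in
  if odd (size s) then a m = a t /\ a b = a 1%N else a m = a b /\ a t = a 1%N.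

Lemma closed_chain_id s a : closed_chain s a -> a \o closing s = a.
Proof.
rewrite /closed_chain /closing; case: ends => [[t m] b].
case: odd => -[am ab]; apply/funext => l; rewrite /= /rename.
- by case: (l =P b) => ?; case: eqP => ?; congruence.
- by case: (l =P t) => ?; case: eqP => ?; congruence.
Qed.

Lemma ends_uniq s n t m b z (l := ends s n t m b) :
  uniq [:: t; m; b; z] -> all (fun i => i < n)%N [:: t; m; b; z] ->
  uniq [:: l.1.1; l.1.2; l.2; z].
Proof.
rewrite {}/l; elim: s n t m b => [//|x s IHs] n t m b.
move=> uq lt_n; case: x; rewrite ?ends_true ?ends_false; apply: IHs.
all: by move: uq lt_n; rewrite /= !inE; lia.
Qed.

(** These are the letter sequences of admissible words: the first and last runs of length 1 fix the
    outer letters, and the length modulo 3 becomes [closes]. *)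
Definition closable (s : seq bool) : bool :=
  [&& head false s, closes s Top & last false s == odd (size s)].

(** The left cap repeats label 0, but the first sigma_1 gives the middle and bottom strands new
    labels. *)
Lemma closable_ends s (l := ends s 2 0 0 1) :
  closable s -> uniq [:: l.1.1; l.1.2; l.2; 1%N].
Proof.
rewrite {}/l; case: s => [|[] s] // _.
by rewrite ends_true; apply: ends_uniq.
Qed.

Lemma closing_ends s (l := ends s 2 0 0 1) : closable s ->
  closing s 1 = 1%N /\
  if odd (size s)
  then [/\ closing s l.1.1 = l.1.1, closing s l.1.2 = l.1.1
         & closing s l.2 = 1%N]
  else [/\ closing s l.1.1 = 1%N, closing s l.1.2 = l.2
         & closing s l.2 = l.2].
Proof.
move=> /closable_ends; rewrite {}/l /closing; case: ends => [[t m] b] /=.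
rewrite !inE !negb_or !andbT.
move=> /and3P[/and3P[/eqP tm /eqP tb /eqP t1] /andP[/eqP mb /eqP m1] /eqP b1].
case: odd; rewrite /rename /=; split; try split.
all: by rewrite ?(eqxx, introF eqP tm, introF eqP tb, introF eqP t1,
  introF eqP mb, introF eqP m1, introF eqP b1, introF eqP (nesym tm),
  introF eqP (nesym tb), introF eqP (nesym t1), introF eqP (nesym mb),
  introF eqP (nesym m1), introF eqP (nesym b1)).
Qed.

Lemma closed_chain_comp s a : closable s -> closed_chain s (a \o closing s).
Proof.
move=> /closing_ends; rewrite /closed_chain /=.
by case: ends => [[t m] b] /= [->]; case: odd => -[-> -> ->].
Qed.

Lemma closes_final s q :
  closes s q -> final s q = if last false s then Top else Bot.
Proof.
elim: s q => [//|x s IHs] q; case: s IHs => [|y s] IHs; last exact: IHs.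
by case: q x {IHs} => [|f|] [].
Qed.

Lemma closable_final s :
  closable s -> final s Top = if odd (size s) then Top else Bot.
Proof. by case/and3P=> _ /closes_final -> /eqP ->. Qed.

Theorem closed_braid_split_form s : closable s ->
  split_form (map (orelabel (closing s)) (obraid s Top 2 0 0 1))
    (fun sg => map (orelabel (closing s)) (essential sg s Top 2 0 0 1)).
Proof.
move=> cs; have fin := closable_final cs; split.
- move=> sg _ /mapP[e eN ->]; have [eE pe] := essential_sub eN.
  by rewrite map_f.
- move=> sg a; rewrite is_cycle_orelabel => ca hN; apply/flat_orelabel.
  have := closed_chain_comp a cs.
  move: hN; rewrite /closed_chain; case Dl: (ends s) => [[t m] b] hN cl.
  have {}hN e : e \in essential sg s Top 2 0 0 1 -> band (a \o closing s) e = 0.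
    by move=> eN; apply: (hN (orelabel (closing s) e)); rewrite map_f.
  case: sg hN => hN;
    [apply: flat_positive_obraid => // | apply: flat_negative_obraid => //].
  + by rewrite fin Dl /=; case: odd cl => // -[/= h _] _; lia.
  + by move=> _; rewrite /= subrr.
  + by rewrite fin Dl /=; case: odd cl => // -[/= h _] _; lia.
- move=> z sz; have [||u [l [v [sv /= u0 zv]]]] := @realizes_exists s Top z 0 0.
  + by case/and3P: cs.
  + by move=> sg; rewrite sz size_map size_essential.
  (* Label 0 gets [l], consistently for top and middle because [upper] is 0 there; label 1 gets
     0. *)
  pose a i := nth 0 [:: l, 0 & v] i.
  have [||||ca az fin_a] := zv 2 0%N 0%N 1%N a.
  + by [].
  + by rewrite /= u0 add0r.
  + by rewrite /= u0 oppr0.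
  + by [].
  have cl : closed_chain s a.
    (* [fin_a] gives the identification in the right cap, and conservation of flux gives the one
       along the outer arc. *)
    have := flux_obraid a s Top 2 0 0 1; rewrite fin big1_seq; last first.
      by move=> e /andP[_ /(allP ca) /eqP ->]; rewrite subrr.
    rewrite /closed_chain; move: fin_a; rewrite fin /at_ends.
    case: ends => [[t m] b] /=.
    by case: odd => /= h h'; split; lia.
  have aE := closed_chain_id cl.
  exists a => [|sg]; first by rewrite is_cycle_orelabel aE.
  rewrite -az -map_comp; apply: eq_map => e /=.
  by rewrite -[RHS]/(band a e) -{2}aE.
- move=> sg a a'; rewrite !is_cycle_orelabel => ca ca'.
  move=> /flat_orelabel fa /flat_orelabel fa'.
  rewrite defect_orelabel defect_obraid //.
  have x0 c c' : is_cycle (obraid s Top 2 0 0 1) c ->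
      is_cycle (obraid s Top 2 0 0 1) c' ->
      flat (obraid s Top 2 0 0 1) sg c -> flat (obraid s Top 2 0 0 1) sg c' ->
      cross_term s Top 2 0 0 1 c c' = 0.
    move=> cc cc'; case: (sg) => fc fc'; last exact: cross_term_flat_negative.
    by rewrite cross_term_flat_positive // fin; case: odd.
  rewrite !x0 // fin.
  (* At both ends the potential reduces to the product of the values on label 1. *)
  have := closed_chain_comp a cs; have := closed_chain_comp a' cs.
  rewrite /closed_chain; case: ends => [[t m] b] /=.
  by case: odd => -[h1 h2] [h3 h4]; rewrite /= ?h1 ?h2 ?h3 ?h4; ring.
Qed.

(** * The two orientations of the closed diagram *)

Definition succ (q q' : state) : bool :=
  match q, q' with
  | Top, Mid _ | Mid _, Bot | Bot, Top => true
  | _, _ => false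
  end.

(* Numbering the positions 0, 1, 2, the two generators act as reflections of
   Z/3. *)
Lemma succ_final s q q' : succ q q' ->
  if odd (size s) then succ (final s q') (final s q)
  else succ (final s q) (final s q').
Proof.
elim: s q q' => [//|x s IHs] q q' qq'.
have : succ (step q' x) (step q x).
  by case: q q' x qq' {IHs} => [|f|] [|f'|] [].
by move=> /IHs /=; case: odd.
Qed.

Definition rights (q : state) (t m b : nat) : seq nat :=
  match q with Top => [:: m; b] | Mid _ => [:: t; b] | Bot => [:: t; m] end.

Definition lefts (q : state) (t m b : nat) : seq nat :=
  match q with Top => [:: t] | Mid _ => [:: m] | Bot => [:: b] end.

Definition compatible (P : seq crossing) (E : seq ocrossing) : bool :=
  all2 (fun x e => e \in orientations x) P E.

Lemma relabel_braid_true f s n t m b :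
  map (relabel f) (braid (true :: s) n t m b).1 =
  (f n.+1, f n, f m, f b) :: map (relabel f) (braid s n.+2 t n n.+1).1.
Proof. by rewrite /=; case: braid. Qed.

Lemma relabel_braid_false f s n t m b :
  map (relabel f) (braid (false :: s) n t m b).1 =
  (f m, f n.+1, f n, f t) :: map (relabel f) (braid s n.+2 n n.+1 b).1.
Proof. by rewrite /=; case: braid. Qed.

Lemma compatible_obraid f s q n t m b :
  compatible (map (relabel f) (braid s n t m b).1)
    (map (orelabel f) (obraid s q n t m b)).
Proof.
elim: s q n t m b => [//|x s IHs] q n t m b.
case: x; rewrite ?relabel_braid_true ?relabel_braid_false /=.
all: rewrite [compatible _ _]/= IHs andbT !inE.
all: by case: q => [|?|]; rewrite eqxx ?orbT.
Qed.

Lemma ins_cons e E : ins (e :: E) = [:: in_l e, in_r e & ins E].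
Proof. by []. Qed.

Lemma outs_cons e E : outs (e :: E) = [:: out_r e, out_l e & outs E].
Proof. by []. Qed.

Lemma ins_reverse E : ins (map reverse E) = outs E.
Proof. by elim: E => [//|e E IHE]; rewrite outs_cons -IHE. Qed.

Lemma outs_reverse E : outs (map reverse E) = ins E.
Proof. by elim: E => [//|e E IHE]; rewrite ins_cons -IHE. Qed.

Lemma ins_orelabel f E : ins (map (orelabel f) E) = map f (ins E).
Proof. by elim: E => [//|e E IHE]; rewrite ins_cons /= -IHE. Qed.

Lemma outs_orelabel f E : outs (map (orelabel f) E) = map f (outs E).
Proof. by elim: E => [//|e E IHE]; rewrite outs_cons /= -IHE. Qed.

Ltac split_bools :=
  rewrite ?negb_or;
  repeat match goal with
  | |- is_true (_ && _) -> _ => case/andP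
  | |- is_true (~~ (_ || _)) -> _ => rewrite negb_or
  | |- _ -> _ => intro
  end;
  repeat (apply/andP; split) => //.

(** Every arc leaves once and enters once, so the directions at the left ends exclude all but one
    orientation of the first crossing; its right ends then satisfy the same hypotheses. *)
Lemma orientation_forced f s q n t m b E :
  compatible (map (relabel f) (braid s n t m b).1) E ->
  uniq (ins E) -> uniq (outs E) ->
  all (fun l => f l \notin outs E) (rights q t m b) ->
  all (fun l => f l \notin ins E) (lefts q t m b) ->
  E = map (orelabel f) (obraid s q n t m b).
Proof.
elim: s q n t m b E => [|x s IHs] q n t m b E; first by case: E.
case: x; rewrite ?relabel_braid_true ?relabel_braid_false; case: E => [//|e E].
all: move=> /andP[]; rewrite !inE => eP PE.
all: have {}IHs q' := IHs q' _ _ _ _ E PE.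
all: rewrite ins_cons outs_cons.
all: case/or4P: eP => /eqP ->.
all: rewrite /in_l /in_r /out_l /out_r [uniq _]/= [uniq (_ :: _)]/=.
all: case: q => [|g|]; rewrite /= !inE ?eqxx ?orbT ?andbF //.
all: move=> uin uout right left; congr (_ :: _); apply: IHs;
  by move: uin uout right left; rewrite /= ?inE; split_bools.
Qed.

Lemma compatible_reverse P E : compatible P E -> compatible P (map reverse E).
Proof.
elim: P E => [|x P IHP] [|e E] //= /andP[eP PE]; rewrite IHP // andbT.
case: x eP => [[[a b] c] d]; rewrite !inE.
by case/or4P=> /eqP ->; rewrite /reverse eqxx ?orbT.
Qed.

Lemma reverseK : involutive reverse.
Proof. by case=> [[[[il ir] or] ol] p]. Qed.

(* Label 0 is shared by the top and middle left ends, so that orientation_forced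
   only applies after the first crossing. *)
Lemma orientation_first f s E :
  compatible (map (relabel f) (braid (true :: s) 2 0 0 1).1) E ->
  uniq (ins E) -> uniq (outs E) ->
  exists2 q, (q = Top) \/ (q = Mid true) &
    E = map (orelabel f) (obraid (true :: s) q 2 0 0 1) \/
    E = map reverse (map (orelabel f) (obraid (true :: s) q 2 0 0 1)).
Proof.
rewrite relabel_braid_true; case: E => [//|e E] /andP[]; rewrite !inE => eP PE.
have PE' := compatible_reverse PE.
have forced q := @orientation_forced f s q 4 0 2 3 E PE.
have := fun q => @orientation_forced f s q 4 0 2 3 _ PE'.
rewrite ins_reverse outs_reverse => forced'.
rewrite ins_cons outs_cons; case/or4P: eP => /eqP ->.
all: rewrite /in_l /in_r /out_l /out_r [uniq _]/= [uniq (_ :: _)]/= !inE.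
all: move=> uin uout.
(* Of the four orientations of the first crossing, the first two are the reverses of the last
   two. *)
- exists Top; first by left.
  right; rewrite /= -(forced' Top) ?mapK //; try exact: reverseK;
  by move: uin uout; rewrite /=; split_bools.
- exists (Mid true); first by right.
  right; rewrite /= -(forced' Bot) ?mapK //; try exact: reverseK;
  by move: uin uout; rewrite /=; split_bools.
- exists Top; first by left.
  left; rewrite /= -(forced Top) //;
  by move: uin uout; rewrite /=; split_bools.
- exists (Mid true); first by right.
  left; rewrite /= -(forced Bot) //;
  by move: uin uout; rewrite /=; split_bools.
Qed.

Lemma count_mem_sum (S : seq nat) (f : nat -> nat) (l : nat) :
  (count_mem l (map f S))%:Z = \sum_(i <- S) (f i == l)%:R.
Proof.
elim: S => [|i S IHS]; first by rewrite big_nil.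
by rewrite big_cons -IHS /= PoszD; case: eqP.
Qed.

(** This is [flux_obraid] for the indicator function of each label. *)
Lemma perm_flux f s q n t m b :
  reflect (forall l, at_ends (flux (final s q)) (fun i => (f i == l)%:R)
             (ends s n t m b) =
           flux q (f t == l)%:R (f m == l)%:R (f b == l)%:R)
    (perm_eq (ins (map (orelabel f) (obraid s q n t m b)))
             (outs (map (orelabel f) (obraid s q n t m b)))).
Proof.
rewrite ins_orelabel outs_orelabel.
have fluxE l : (count_mem l (map f (outs (obraid s q n t m b))))%:Z -
    (count_mem l (map f (ins (obraid s q n t m b))))%:Z =
    at_ends (flux (final s q)) (fun i => (f i == l)%:R) (ends s n t m b) -
    flux q (f t == l)%:R (f m == l)%:R (f b == l)%:R.
  rewrite !count_mem_sum sum_ins sum_outs -sumrB.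
  exact: (flux_obraid (fun i => (f i == l)%:R)).
apply: (iffP idP) => [/permP io l | io].
  by apply/eqP; rewrite -subr_eq0 -fluxE io subrr.
apply/allP => l _; have /eqP := fluxE l.
by rewrite io subrr subr_eq0 => /eqP[/= ->].
Qed.

Lemma all_notin (P : pred nat) (S : seq nat) i :
  all P S -> ~~ P i -> i \notin S.
Proof. by move=> PS; apply: contra => /(allP PS). Qed.

(** An arc running right enters one later crossing or survives to the right end; a new arc running
    left enters the crossing that creates it. *)
Lemma ins_uniq s q n t m b (l := ends s n t m b)
    (S := ins (obraid s q n t m b) ++ rights (final s q) l.1.1 l.1.2 l.2) :
  uniq (rights q t m b) -> all (fun i => i < n)%N (rights q t m b) ->
  uniq S /\ all (fun i => (i \in rights q t m b) || (n <= i)%N) S.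
Proof.
rewrite {}/S {}/l; elim: s q n t m b => [|x s IHs] q n t m b.
  by move=> uq _; split=> //; apply/allP => i ->.
move=> uq lt_n; case: x; rewrite ?ends_true ?ends_false [obraid _ _ _ _ _ _]/=.
all: rewrite ins_cons [final _ _]/=.
1: move: (IHs (step q true) n.+2 t n n.+1).
2: move: (IHs (step q false) n.+2 n n.+1 b).
all: move=> [||uqS allS];
  try by move: uq lt_n; case: (q) => [|f|]; rewrite /= !inE; lia.
all: have notinS i := all_notin (i := i) allS; split.
1,3: rewrite /= inE uqS andbT negb_or -andbA; apply/and3P; split;
  [|apply: notinS | apply: notinS];
  by move: uq lt_n; case: (q) => [|f|]; rewrite /= !inE /in_l /in_r /=; lia.
all: rewrite [all _ _]/=; apply/and3P; split;
  [| |apply: sub_all allS => i; move: uq lt_n];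
  by case: (q) => [|f|]; rewrite /= !inE /in_l /in_r /=; lia.
Qed.

Definition standard (s : seq bool) : seq ocrossing :=
  map (orelabel (closing s)) (obraid s Top 2 0 0 1).

Lemma orients_standard s : closable s -> orients (close_braid s) (standard s).
Proof.
move=> cs; have fin := closable_final cs; have [f1 fe] := closing_ends cs.
have ue := closable_ends cs.
rewrite /orients close_braidE; apply/and3P; split.
- exact: compatible_obraid.
- rewrite -/(ins _) ins_orelabel.
  have [//|//|] := @ins_uniq s Top 2 0 0 1.
  rewrite fin cat_uniq => /and3P[uq no_rights _] _.
  (* The renamed labels run to the right at the right end, so they enter no crossing of the open
     braid. *)
  suff /eq_in_map -> : {in ins (obraid s Top 2 0 0 1), closing s =1 id}.
    by rewrite map_id.
  move=> i iE.
  move: no_rights; rewrite /closing; case: ends => [[t m] b] /=.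
  case: odd => /=; rewrite orbF negb_or /rename => /andP[h1 h2] /=.
  + have -> : (i == b) = false by apply: contraNF h2 => /eqP <-.
    by have -> : (i == m) = false by apply: contraNF h1 => /eqP <-.
  + have -> : (i == t) = false by apply: contraNF h1 => /eqP <-.
    by have -> : (i == m) = false by apply: contraNF h2 => /eqP <-.
- apply/perm_flux => l; rewrite fin /at_ends.
  move: fe; case: ends => [[t m] b] /=.
  by case: odd => -[-> -> ->]; rewrite /= f1; ring.
Qed.

Lemma orients_unique s E : closable s -> orients (close_braid s) E ->
  E = standard s \/ E = map reverse (standard s).
Proof.
move=> cs /and3P[]; rewrite -/(ins E) -/(outs E) close_braidE => cE uin io.
have uout : uniq (outs E) by rewrite -(perm_uniq io).
have [f1 fe] := closing_ends cs; have ue := closable_ends cs.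
have fin := closable_final cs.
have Ds : s = true :: behead s by case: (s) cs => [|[] ?].
rewrite Ds in cE.
have [q [->|qE]] := orientation_first cE uin uout; rewrite -Ds // => EE.
have {EE} io' : perm_eq (ins (map (orelabel (closing s)) (obraid s q 2 0 0 1)))
    (outs (map (orelabel (closing s)) (obraid s q 2 0 0 1))).
  case: EE io => ->; rewrite Ds // ins_reverse outs_reverse perm_sym //.
(* A start in [Mid true] is impossible: label 1 would have flux 1 on the left, but -1 on the right
   by [succ_final]. *)
move: io'; rewrite {}qE => /perm_flux /(_ 1%N).
have := @succ_final s Top (Mid true) isT; rewrite fin /at_ends.
move: fe ue; case: ends => [[t m] b] /=; rewrite f1 !inE eqxx !negb_or !andbT.
move=> fe /and3P[/and3P[_ _ t1] /andP[_ m1] b1].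
case: odd fe => -[-> -> ->].
all: by case: final => //; rewrite ?eqxx /= ?(negPf t1) ?(negPf b1);
  case: (_ == _).
Qed.

(** Both possible orientations have split forms with the same numbers of essential crossings. *)
Theorem knot_signature_closable s (sg : int) : closable s ->
  knot_signature (close_braid s) sg <->
  sg = (nb_essential false s Top)%:Z - (nb_essential true s Top)%:Z.
Proof.
move=> cs; have spE := closed_braid_split_form cs.
have oE := orients_standard cs.
have /and3P[_ _ io] := oE; have spE' := split_form_reverse io spE.
split=> [[E EP [n [V VE <-]]] | ->].
  have [DE|DE] := orients_unique cs EP; rewrite DE in VE.
    by rewrite (split_signature spE VE) !size_map !size_essential.
  by rewrite (split_signature spE' VE) !size_map !size_essential.
exists (standard s) => //; have [n [V VE]] := split_seifert_matrix spE.
exists n, V => //.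
by rewrite (split_signature spE VE) !size_map !size_essential.
Qed.

(** * Words, letters and admissibility *)

Fixpoint word (b : bool) (s : seq bool) : seq bool :=
  if s is x :: s' then
    nseq (if x == b then 1%N else 2) b ++ word (~~ b) s'
  else [::].

Lemma runs_word b s :
  runs (word b s) =
  if s is x :: s' then
    (b, if x == b then 1%N else 2) :: runs (word (~~ b) s')
  else [::].
Proof.
elim: s b => [//|x s IHs] b.
have {}IHs : runs (word (~~ b) s) = [::] \/
    exists k r, runs (word (~~ b) s) = (~~ b, k) :: r.
  by rewrite IHs; case: s {IHs} => [|y s]; [left | right; eexists; eexists].
case: IHs => [IHs|[k [r IHs]]]; case: (x =P b) => xb.
all: by rewrite /= (introF eqP xb) /= || rewrite /= xb eqxx /=;
  rewrite /= IHs ?eqxx //; case: b {xb IHs}.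
Qed.

Lemma letters_word s : letters (word true s) = s.
Proof.
elim: s true => [//|x s IHs] b; rewrite /letters runs_word /= -/(letters _) IHs.
by congr (_ :: _); case: b x => [] [].
Qed.

Definition eps_of (c : nat) (s : seq bool) : {ffun 'I_c -> 'I_3} :=
  [ffun i : 'I_c => inord (if nth false s i == ~~ odd i then 1 else 2)].

Lemma eps_ofE c s (i : 'I_c) :
  eps_of c s i = (if nth false s i == ~~ odd i then 1%N else 2) :> nat.
Proof. by rewrite ffunE inordK //; case: eqP. Qed.

Lemma flatten_word b s :
  flatten [seq nseq (if nth false s i == b (+) odd i then 1%N else 2)
                    (b (+) odd i) | i <- iota 0 (size s)] = word b s.
Proof.
elim: s b => [//|x s IHs] b.
rewrite /= addbF; congr (_ ++ _).
rewrite -IHs -[1%N]addn0 iotaDl -map_comp; congr flatten; apply: eq_map => i /=.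
by rewrite addbN addNb.
Qed.

Lemma word_of_eps_of c s : size s = c -> word_of (eps_of c s) = word true s.
Proof.
move=> sz; rewrite /word_of -flatten_word sz -val_enum_ord -map_comp.
by congr flatten; apply: eq_map => i /=; rewrite eps_ofE.
Qed.

Lemma sum_eps (c : nat) (eps : {ffun 'I_c -> 'I_3}) :
  (\sum_(i < c) eps i)%N = size (word_of eps).
Proof.
rewrite size_flatten /shape -map_comp sumnE big_map big_enum /=.
by apply: eq_bigr => i _; rewrite size_nseq.
Qed.

(* The state of the standard orientation is the position modulo 3 in the word,
   suitably encoded according to the parity b of the run. *)
Definition reached (b : bool) (q : state) (p : nat) : bool :=
  match q with
  | Top => p %% 3 == ~~ b
  | Mid _ => p %% 3 == 2
  | Bot => p %% 3 == b
  end%N.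

Lemma reached_final b q p s : reached b q p ->
  reached (b (+) odd (size s)) (final s q) (p + size (word b s)).
Proof.
elim: s b q p => [|x s IHs] b q p; first by rewrite addbF addn0.
move=> qp; rewrite /= size_cat size_nseq addnA addbN -addNb; apply: IHs.
by move: qp; rewrite /reached; case: q => [|f|]; case: b x => [] [] /=; lia.
Qed.

Lemma closes_iff s q : s != [::] ->
  closes s q = match final s q with
               | Top => last false s
               | Mid _ => false
               | Bot => ~~ last false s
               end.
Proof.
elim: s q => [//|x s IHs] q _; case: s IHs => [|y s] IHs; last exact: IHs.
by case: q x {IHs} => [|f|] [].
Qed.

(** By [reached_final], length 1 modulo 3 means that the final state is [Top] for odd c and [Bot]
    for even c. *)
Lemma admissible_eps_of c s : (1 < c)%N -> size s = c ->
  admissible (eps_of c s) = closable s.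
Proof.
move=> c_gt1 sz; have c_gt0 := ltnW c_gt1.
have s_nil : s != [::] by rewrite -size_eq0 sz -lt0n.
have := @reached_final true Top 0 s isT; rewrite addTb add0n sz.
rewrite /admissible sum_eps word_of_eps_of // /closable closes_iff // sz.
have -> : [forall i, (eps_of c s i == 1%N :> nat) ||
                     (eps_of c s i == 2 :> nat)].
  by apply/forallP => i; rewrite eps_ofE; case: ifP.
have -> : [forall i : 'I_c, (i == 0%N :> nat) || (i.+1 == c) ==>
    (eps_of c s i == 1%N :> nat)] = head false s && (last false s == odd c).
  apply/forallP/andP => [eps1|[h l] i].
    split.
      have := eps1 (Ordinal c_gt0); rewrite eqxx eps_ofE /= nth0.
      by case: head.
    have lt_c : (c.-1 < c)%N by rewrite prednK.
    have := eps1 (Ordinal lt_c); rewrite eps_ofE /= prednK // eqxx orbT.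
    have -> : odd c = ~~ odd c.-1 by rewrite -{1}(prednK c_gt0).
    by rewrite -nth_last sz; case: ifP.
  apply/implyP => /orP[/eqP i0|/eqP ic]; rewrite eps_ofE.
    by rewrite i0 nth0 h.
  have ci : c.-1 = i := congr1 predn (esym ic).
  have oc : odd c = ~~ odd i := congr1 odd (esym ic).
  by move: l; rewrite -nth_last sz ci oc => ->.
rewrite andTb -!andbA; case: (head false s) => //=.
case: eqP => [->|_]; last by rewrite andbF.
by rewrite andbT; case: final => [|f|]; case: odd => /=; lia.
Qed.

Lemma eps_of_admissible (c : nat) (eps : {ffun 'I_c -> 'I_3}) :
  admissible eps ->
  eps = eps_of c
    [seq (eps i == 1%N :> nat) == ~~ odd i | i : 'I_c <- enum 'I_c].
Proof.
case/and3P=> /forallP eps12 _ _; apply/ffunP => i; apply: ord_inj.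
rewrite eps_ofE (nth_map i) ?size_enum_ord // nth_ord_enum.
by have := eps12 i; case: eqP => [->|_ /= /eqP ->]; case: odd.
Qed.

Lemma mem_T c w : (1 < c)%N ->
  reflect (exists s, [/\ size s = c, closable s & w = word true s]) (w \in T c).
Proof.
move=> c_gt1; rewrite /T; apply: (iffP (imfsetP _ _ _ _)) => /=.
  move=> [eps adm ->]; rewrite inE in adm.
  set s := [seq (eps i == 1%N :> nat) == ~~ odd i | i : 'I_c <- enum 'I_c].
  have sz : size s = c by rewrite size_map size_enum_ord.
  have De : eps = eps_of c s by exact: eps_of_admissible.
  exists s; split=> //; first by rewrite -(admissible_eps_of c_gt1 sz) -De.
  by rewrite De word_of_eps_of.
move=> [s [sz cs ->]]; exists (eps_of c s); last by rewrite word_of_eps_of.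
by rewrite inE admissible_eps_of.
Qed.

(** * Counting paths and binomial coefficients *)

Fixpoint bseqs (n : nat) : seq (seq bool) :=
  if n is n'.+1 then map (cons true) (bseqs n') ++ map (cons false) (bseqs n')
  else [:: [::]].

Lemma mem_bseqs n s : (s \in bseqs n) = (size s == n).
Proof.
elim: n s => [|n IHn] [|x s] //=; rewrite mem_cat.
  by apply/negP => /orP[] /mapP[].
apply/orP/eqP.
- by case=> /mapP[t]; rewrite IHn => /eqP <- [_ ->].
- by case=> sz; case: x; [left | right]; rewrite map_f // IHn sz.
Qed.

Lemma uniq_bseqs n : uniq (bseqs n).
Proof.
elim: n => [//|n IHn] /=; rewrite cat_uniq !map_inj_uniq ?IHn /=;
  try by move=> ? ? [].
by rewrite andbT; apply/hasPn => _ /mapP[s _ ->]; apply/mapP => -[].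
Qed.

Definition weight (s : seq bool) (q : state) : int :=
  (nb_essential false s q)%:Z - (nb_essential true s q)%:Z.

Lemma count_signature_T c (sg : int) : (1 < c)%N ->
  count_signature (T c) sg =
  count (fun s => closable s && (weight s Top == sg)) (bseqs c).
Proof.
move=> c_gt1; rewrite -size_filter -(size_map (word true)).
rewrite /count_signature.
have word_inj : injective (word true) by exact: can_inj letters_word.
rewrite -(undup_id (s := map _ _)) ?map_inj_uniq ?filter_uniq ?uniq_bseqs //.
rewrite -card_fseq; congr #|` _|.
apply/fsetP => w; rewrite !inE /=.
apply/andP/mapP => [[/(mem_T _ c_gt1)[s [sz cs ->]]] | [s]].
  rewrite /D letters_word => /asboolP/(knot_signature_closable sg cs) ->.
  by exists s; rewrite // mem_filter cs mem_bseqs sz !eqxx.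
rewrite mem_filter mem_bseqs => /andP[/andP[cs /eqP wt] /eqP sz] ->; split.
  by apply/(mem_T _ c_gt1); exists s.
by apply/asboolP; rewrite /D letters_word; apply/knot_signature_closable.
Qed.

(** For a closing path the last letter [e] tells the end: [Top] for sigma_1, [Bot] for
    sigma_2^-1. *)
Definition nb_paths (q : state) (e : bool) (n : nat) (w : int) : nat :=
  count (fun s => [&& closes s q, last false s == e & weight s q == w])
    (bseqs n).

Definition step_weight (q : state) (x : bool) : int :=
  (is_essential false q x false)%:Z - (is_essential true q x false)%:Z.

Lemma count_bseqsS (p : pred (seq bool)) n :
  count p (bseqs n.+1) =
  (count (fun s => p (true :: s)) (bseqs n) +
   count (fun s => p (false :: s)) (bseqs n))%N.
Proof. by rewrite count_cat !count_map. Qed.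

Lemma weight_cons x s q : s != [::] ->
  weight (x :: s) q = step_weight q x + weight s (step q x).
Proof.
by case: s => // y s _; rewrite /weight /step_weight /= !PoszD; ring.
Qed.

Lemma nb_paths_cons x q e n w :
  count (fun s => [&& closes (x :: s) q, last false (x :: s) == e &
                      weight (x :: s) q == w]) (bseqs n.+1) =
  nb_paths (step q x) e n.+1 (w - step_weight q x).
Proof.
apply: eq_in_count => s; rewrite mem_bseqs => sz.
have s0 : s != [::] by case: (s) sz.
rewrite weight_cons // [RHS]andbA [LHS]andbA; congr (_ && _).
  by case: (s) s0.
by apply/eqP/eqP; lia.
Qed.

Lemma nb_pathsS q e n w :
  nb_paths q e n.+2 w =
  (nb_paths (step q true) e n.+1 (w - step_weight q true) +
   nb_paths (step q false) e n.+1 (w - step_weight q false))%N.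
Proof. by rewrite [LHS]count_bseqsS !nb_paths_cons. Qed.

(** The coefficient of x^w in (x + 1/x)^n. *)
Fixpoint nb_walks (n : nat) (w : int) : nat :=
  if n is n'.+1 then (nb_walks n' (w - 1) + nb_walks n' (w + 1))%N
  else (w == 0).

Definition shift (q : state) : int :=
  match q with Top | Mid false => 0 | Bot | Mid true => -1 end.

(* The generating function of the left-hand side is (x + 1/x)^n x^(shift q):
   both sides satisfy the recursion nb_pathsS. *)
Lemma nb_pathsD q n w :
  (nb_paths q true n.+1 w + nb_paths q false n.+2 w)%N =
  nb_walks n (w - shift q).
Proof.
elim: n q w => [|n IHn] q w.
  rewrite nb_pathsS.
  case: q => [|[]|]; rewrite /nb_paths /weight /step_weight /= !addn0 ?add0n.
  1-4: by congr (nat_of_bool _); apply/eqP/eqP; lia.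
rewrite !(nb_pathsS q) addnACA !IHn [RHS]/=.
case: q => [|[]|]; rewrite /step_weight /=.
all: do [by congr (nb_walks _ _ + nb_walks _ _)%N; ring |
         by rewrite addnC; congr (nb_walks _ _ + nb_walks _ _)%N; ring].
Qed.

Lemma binomz_pascal n (k : int) :
  binomz n.+1 k = (binomz n (k - 1) + binomz n k)%N.
Proof.
case: k => [[|k]|k].
- by rewrite /= !bin0.
- by rewrite -[k.+1]addn1 PoszD addrK /= addn1 binS addnC.
- by rewrite (_ : Negz k - 1 = Negz k.+1) // !NegzE; lia.
Qed.

(** A walk of n steps with k steps up has sum 2k - n. *)
Lemma nb_walks_binomz n (k : int) : nb_walks n (2 * k - n%:Z) = binomz n k.
Proof.
elim: n k => [|n IHn] k; first by case: k => [[|k]|k].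
rewrite binomz_pascal -!IHn [LHS]/=; congr (nb_walks _ _ + nb_walks _ _)%N; lia.
Qed.

Lemma count_signature_nb_paths c (sg : int) : (1 < c)%N ->
  count_signature (T c) sg = nb_paths Top (odd c) c.-1 (sg - 1).
Proof.
case: c => [|[|c]] // _; rewrite count_signature_T // count_bseqsS.
rewrite [X in (_ + X)%N](eq_count (a2 := pred0)) // count_pred0 addn0.
(* The first letter must be sigma_1, which stays in [Top] with weight 1; it is split off. *)
rewrite -[sg - 1]/(sg - step_weight Top true) -(nb_paths_cons true Top).
apply: eq_in_count => s; rewrite mem_bseqs => /eqP sz.
by rewrite /closable [head _ _]/= andTb -andbA [size _]/= sz.
Qed.

(** A word determines its letters, and their number is c. *)
Lemma disjoint_T c c' : (1 < c)%N -> (1 < c')%N -> c != c' ->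
  (T c `&` T c' = fset0)%fset.
Proof.
move=> c1 c1' /eqP cc'; apply/fsetP => w; rewrite !inE.
apply/andP => -[/(mem_T _ c1)[s [sz _ ->]] /(mem_T _ c1')[s' [sz' _]]].
move=> /(congr1 letters); rewrite !letters_word => ss.
by apply: cc'; congruence.
Qed.

Lemma count_signatureU (A B : {fset seq bool}) (sg : int) :
  (A `&` B = fset0)%fset ->
  count_signature (A `|` B)%fset sg =
  (count_signature A sg + count_signature B sg)%N.
Proof.
move=> AB0; rewrite /count_signature.
set p := fun w => `[< knot_signature (D w) sg >].
have -> : [fset w in A `|` B | p w]%fset =
    ([fset w in A | p w] `|` [fset w in B | p w])%fset.
  by apply/fsetP => w; rewrite !inE andb_orl.
rewrite cardfsU; set I := (_ `&` _)%fset.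
suff -> : I = fset0 by rewrite cardfs0 subn0.
apply/fsetP => w; rewrite !inE; apply/negP => /andP[/andP[wA _] /andP[wB _]].
by have : w \in (A `&` B)%fset; [rewrite inE wA wB | rewrite AB0 inE].
Qed.

Theorem theorem3p8 (m : nat) (k sigma : int) (hm : (1 <= m)%N)
    (hsigma : sigma = 2 * k - 2 * m%:Z + 2) :
  [/\ count_signature (T (2 * m + 1)%N `|` T (2 * m + 2)%N)%fset sigma
        = binomz (2 * m - 1)%N k,
      binomz (2 * m - 1)%N k
        = binomz (2 * m - 1)%N (m%:Z - 1 + (sigma %/ 2)%Z)
    & (count_signature (T (2 * m + 1)%N) sigma
         + count_signature (T (2 * m + 2)%N) sigma)%N
        = binomz (2 * m - 1)%N k].
Proof.
have Dsg : (sigma %/ 2)%Z = k - m%:Z + 1.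
  by rewrite hsigma (_ : _ + 2 = (k - m%:Z + 1) * 2) ?mulzK //; ring.
have counts : (count_signature (T (2 * m + 1)%N) sigma
         + count_signature (T (2 * m + 2)%N) sigma)%N
        = binomz (2 * m - 1)%N k.
  rewrite !count_signature_nb_paths; try lia.
  have [-> ->] : odd (2 * m + 1) = true /\ odd (2 * m + 2) = false by lia.
  have [-> ->] : (2 * m + 1).-1 = (2 * m - 1).+1 /\
                 (2 * m + 2).-1 = (2 * m - 1).+2 by lia.
  (* sigma - 1 = 2k - (2m - 1) is the sum of a walk of 2m - 1 steps with k steps up. *)
  rewrite nb_pathsD -nb_walks_binomz; congr nb_walks.
  by rewrite hsigma /=; lia.
split=> //; last by congr binomz; rewrite Dsg; ring.
by rewrite count_signatureU // disjoint_T //; lia.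
Qed.
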